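(* Let $\tau\ge0$ and let $(\theta_\varepsilon)$ be the closed-form parameters defined in the context (either in the MLMC case or in the ML2R case). When $\beta>1$, let $d_\infty\in(0,+\infty)$ denote the limit of $K(\varepsilon)\sum_{r=1}^{R(\varepsilon)}q_r(\varepsilon)2^{r-1}$ as $\varepsilon\to0$. For any real-valued function $v$ defined on a right neighbourhood of $0$ such that $\limsup_{\varepsilon\to0}v(\varepsilon)\tilde{\mathcal C}_0(\theta_\varepsilon)<+\infty$, one has $$\limsup_{\varepsilon\to0}v(\varepsilon)\tilde{\mathcal C}_\tau(\theta_\varepsilon)\le\mathcal K_\beta\,\limsup_{\varepsilon\to0}v(\varepsilon)\tilde{\mathcal C}_0(\theta_\varepsilon),\qquad \mathcal K_\beta:=\begin{cases}1&\beta\le1,\\ \frac{\tau}{d_\infty}+1&\beta>1.\end{cases}$$ Therefore, for every $\tau\ge0$, the following complexities (known for $\tau=0$) hold and are achieved with the parameters $\theta_\varepsilon$: (a) ML2R case: if $(\mathrm{WE}_\alpha)$ holds for some $\alpha>0$ and $(\mathrm{Var}_\beta)$ for some $\beta>0$, $\sup_{R}\sup_{k}|\eta_R(k)|<\infty$ and $\tilde c_\infty>0$, then there is a finite constant $C\ge0$ with $\limsup_{\varepsilon\to0}v(\varepsilon,\beta)\,\tilde{\mathcal C}_\tau(\theta_\varepsilon)\le C$, and $\limsup_{\varepsilon\to0}\varepsilon^{-2}\mathcal M(\theta_\varepsilon)\le1$, where $v(\varepsilon,\beta)=\varepsilon^2$ if $\beta>1$, $v(\varepsilon,\beta)=\varepsilon^2(\log(1/\varepsilon))^{-1}$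 if $\beta=1$, and $v(\varepsilon,\beta)=\varepsilon^2\exp\!\big(-\frac{1-\beta}{\sqrt\alpha}\sqrt{2\ln(1/\varepsilon)\ln 2}\big)$ if $\beta<1$. (b) MLMC case: if $(\mathrm{WE}_{\alpha,1})$ holds for some $\alpha>0$ with $c_1\neq0$ and $(\mathrm{Var}_\beta)$ holds for some $\beta>0$, then there is a finite constant $C\ge0$ with $\limsup_{\varepsilon\to0}v(\varepsilon,\beta)\,\tilde{\mathcal C}_\tau(\theta_\varepsilon)\le C$, and $\limsup_{\varepsilon\to0}\varepsilon^{-2}\mathcal M(\theta_\varepsilon)\le1$, where $v(\varepsilon,\beta)=\varepsilon^2$ if $\beta>1$, $v(\varepsilon,\beta)=\varepsilon^2(\log(1/\varepsilon))^{-2}$ if $\beta=1$, and $v(\varepsilon,\beta)=\varepsilon^{2+\frac{1-\beta}{\alpha}}$ if $\beta<1$.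
   Context: Nested setting: $X$ ($\mathbb{R}^d$-valued, absolutely continuous law) and $U$ ($\mathbb{R}^q$-valued) are independent, $F$ is Borel with $F(X,U)\in L^2$, $L=\mathbb{E}[F(X,U)\mid X]$, $f:\mathbb{R}\to\mathbb{R}$ measurable, $Y=f(L)\in L^2$, $I=\mathbb{E}[Y]$. For $N\ge1$, $Y_N=f(\frac1N\sum_{n=1}^NF(X,U_n))$ with $U_n$ i.i.d. copies of $U$ independent of $X$, $Y_N\in L^2$. $(\Delta Y_{2N})_{N\ge1}$ is a family of square-integrable random variables with $\mathbb{E}[\Delta Y_{2N}]=\mathbb{E}[Y_{2N}-Y_N]$. Assumptions. $(\mathrm{WE}_{\alpha,R})$: there are reals $c_1,\dots,c_R$ and $\eta_R:\mathbb{N}\to\mathbb{R}$ with $\eta_R(N)\to0$ as $N\to\infty$ and $\mathbb{E}[Y_N]=\mathbb{E}[Y]+\sum_{r=1}^Rc_rN^{-\alpha r}+N^{-\alpha R}\eta_R(N)$. $(\mathrm{WE}_\alpha)$: this holds for all $R\ge1$ with a common sequence $(c_r)$; then $\tilde c_\infty:=\lim_R|c_R|^{1/R}$, assumed to exist. $(\mathrm{Var}_\beta)$: there are constants $V_1,\bar\sigma>0$ with $\mathrm{Var}[\Delta Y_{2N}]\le V_1(2N)^{-\beta}$ and $\mathrm{Var}[Y_N]\le\bar\sigma^2$ for all $N\ge 1$. Parameters and estimator. $\Theta$ is the set of $\theta=(J,q,K,R)$ with $J,K\in(0,\infty)$, $R\ge 1$ an integer, $q_1,\dots,q_R>0$ with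 $\sum_{r=1}^Rq_r=1$ ($q_r=0$ for $r>R$). $K_r=\lceil K\rceil2^{r-1}$, $J_r=\lceil Jq_r\rceil$. Weights: in the MLMC (standard) case $A_r^R=1$; in the ML2R (weighted) case $A_r^R=W_r^R=\sum_{i=r}^Rw_i$ with $w_i=(-1)^{R-i}\prod_{1\le j\le R,\,j\ne i}|1-2^{\alpha(j-i)}|^{-1}$. The estimator is $\hat I_\theta=\frac1{J_1}\sum_{j=1}^{J_1}Y_{K_1}^j+\sum_{r=2}^R\frac{A_r^R}{J_r}\sum_{j=1}^{J_r}\Delta Y_{K_r}^j$, where $Y^j_{K_1}$, $\Delta Y^j_{K_r}$ are copies of $Y_{K_1}$, $\Delta Y_{K_r}$, all independent. $\mathcal M(\theta)=\mathbb{E}[(I-\hat I_\theta)^2]$. Approximate cost: $\tilde{\mathcal C}_\tau(\theta)=J\sum_{r=1}^Rq_r(\tau+K_r)$, where $\tau$ is the cost of sampling $X$ relative to the cost of one inner sample. Closed-form parameters $\theta_\varepsilon=(J(\varepsilon),q(\varepsilon),K(\varepsilon),R(\varepsilon))$. Here $\alpha,\beta,V_1,\bar\sigma>0$ and $c_1$ are the constants of the assumptions, $\underline K\ge1$ is a fixed integer, and in the ML2R case $\tilde c$ is a fixed constant with $\tilde c>\tilde c_\infty$. - ML2R: with $b=\frac12+\log_2(\tilde c^{1/\alpha}/\underline K)$, $R(\varepsilon)=\big\lceil b+\sqrt{b^2+\tfrac2\alpha\log_2(\varepsilon^{-1}\sqrt{1+4\alpha})}\big\rceil$, and, with $R=R(\varepsilon)$,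 $K^+(\varepsilon)=(1+2\alpha R)^{\frac1{2\alpha R}}\varepsilon^{-\frac1{\alpha R}}\tilde c^{1/\alpha}2^{-\frac{R-1}2}$, $M_\varepsilon=1+\frac1{2\alpha R}$. - MLMC: $R(\varepsilon)=\big\lceil1+\log_2(|c_1|^{1/\alpha}/\underline K)+\tfrac1\alpha\log_2(\sqrt{1+2\alpha}\,\varepsilon^{-1})\big\rceil$, and, with $R=R(\varepsilon)$, $K^+(\varepsilon)=(1+2\alpha)^{\frac1{2\alpha}}\varepsilon^{-1/\alpha}|c_1|^{1/\alpha}2^{-(R-1)}$, $M_\varepsilon=1+\frac1{2\alpha}$. - Both: $K(\varepsilon)=\underline K\lceil K^+(\varepsilon)/\underline K\rceil$; $q_1(\varepsilon)=\bar\sigma/\mu_\varepsilon$, $q_r(\varepsilon)=\frac{\sqrt{V_1}|A_r^{R(\varepsilon)}|}{\underline K^{\beta/2}2^{(1+\beta)(r-1)/2}\mu_\varepsilon}$ for $2\le r\le R(\varepsilon)$, with $\mu_\varepsilon$ such that $\sum_{r=1}^{R(\varepsilon)}q_r(\varepsilon)=1$; $J(\varepsilon)=\frac{M_\varepsilon}{\varepsilon^2}\Big(\frac{\bar\sigma^2}{q_1(\varepsilon)}+\sum_{r=2}^{R(\varepsilon)}\frac{(A_r^{R(\varepsilon)})^2V_1}{q_r(\varepsilon)K(\varepsilon)^\beta2^{(r-1)\beta}}\Big)$.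
   Formalization: In (a), the bound on M(θ_ε) assumes in addition: if K̲=1 and c̃<1, then η_R(1)→0 as R→∞ (it fails otherwise). For ML2R with β>1 the limit d_∞ does not exist: the inequality is stated if the limit exists, and also with the lim inf in its place for v≥0. *)

(* Defs.v *)
(* MathComp-Analysis: everything is stated over an arbitrary R : realType. *)
From HB Require Import structures.
From mathcomp Require Import all_boot all_order all_algebra.
From mathcomp Require Import all_classical all_reals all_analysis.
Set Implicit Arguments.
Unset Strict Implicit.
Unset Printing Implicit Defensive.
Import Order.TTheory GRing.Theory Num.Theory.
Import numFieldNormedType.Exports.
Local Open Scope classical_set_scope.
Local Open Scope ring_scope.

(** R^n is [n.-tuple R] with its product (= Borel) sigma-algebra. *)

(* n-dimensional Lebesgue measure of a Borel set, as an iterated integral. *)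
Fixpoint lebesgue_tuple (R : realType) (n : nat) : set (n.-tuple R) -> \bar R :=
  match n with
  | 0 => fun A => (\1_A [tuple] : R)%:E
  | m.+1 => fun A => (\int[@lebesgue_measure R]_x
              lebesgue_tuple [set t : m.-tuple R | A [tuple of x :: t]])%E
  end.

Section Probability.
Context (R : realType) (d : measure_display) (T : measurableType d)
  (P : probability T R).

Definition abs_continuous_law (n : nat) (X : T -> n.-tuple R) : Prop :=
  forall A : set (n.-tuple R), measurable A ->
    lebesgue_tuple A = 0%E -> P (X @^-1` A) = 0%E.

Definition sigma_of (d' : measure_display) (E : measurableType d') (X : T -> E) :
  set_system T := preimage_set_system setT X measurable.

(* Mutual independence of the sigma-algebras [G i], [i] ranging over [D]. *)
Definition mutual_indep (I : eqType) (D : set I) (G : I -> set_system T) : Prop :=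
  forall (s : seq I) (A : I -> set T), uniq s ->
    (forall i, i \in s -> D i /\ G i (A i)) ->
    P (\bigcap_(i in [set` s]) A i) = (\prod_(i <- s) P (A i))%E.

Definition indep_rv (d1 d2 : measure_display) (E1 : measurableType d1)
    (E2 : measurableType d2) (X : T -> E1) (Y : T -> E2) : Prop :=
  forall A B, measurable A -> measurable B ->
    P (X @^-1` A `&` Y @^-1` B) = (P (X @^-1` A) * P (Y @^-1` B))%E.

Definition is_cond_exp (d' : measure_display) (E : measurableType d')
    (Z : T -> R) (X : T -> E) (L : T -> R) : Prop :=
  [/\ forall B : set R, measurable B -> sigma_of X (L @^-1` B),
      P.-integrable setT (EFin \o L)
    & forall A, sigma_of X A ->
        (\int[P]_(w in A) (L w)%:E = \int[P]_(w in A) (Z w)%:E)%E].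

End Probability.

Definition same_law (R : realType) (d d' d'' : measure_display)
    (T : measurableType d) (P : probability T R)
    (T' : measurableType d') (P' : probability T' R)
    (E : measurableType d'') (X : T -> E) (X' : T' -> E) : Prop :=
  forall B, measurable B -> P (X @^-1` B) = P' (X' @^-1` B).

Section Nested.
Context (R : realType) (d : measure_display) (T : measurableType d)
  (P : probability T R) (dX dU : nat).

(* The inner samples U_1, U_2, ... are [Us 0], [Us 1], ... *)
Definition nested_Y (F : dX.-tuple R * dU.-tuple R -> R) (f : R -> R)
    (X : T -> dX.-tuple R) (Us : nat -> T -> dU.-tuple R) (N : nat) : T -> R :=
  fun w => f (N%:R^-1 * \sum_(n < N) F (X w, Us n w)).

(* [DY m] is Delta Y_m; only even [m = 2N], [N >= 1], are constrained. *)
Record nested_setting (F : dX.-tuple R * dU.-tuple R -> R) (f : R -> R)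
    (X : T -> dX.-tuple R) (U : T -> dU.-tuple R) (Us : nat -> T -> dU.-tuple R)
    (L : T -> R) (DY : nat -> T -> R) : Prop := {
  ns_X : measurable_fun setT X;
  ns_U : measurable_fun setT U;
  ns_Xac : abs_continuous_law P X;
  ns_XU : indep_rv P X U;
  ns_F : measurable_fun setT F;
  ns_FL2 : (fun w => F (X w, U w)) \in Lfun P 2%:E;
  ns_L : is_cond_exp P (fun w => F (X w, U w)) X L;
  ns_f : measurable_fun setT f;
  ns_Y : (f \o L) \in Lfun P 2%:E;
  ns_Us : forall n, measurable_fun setT (Us n);
  ns_Us_law : forall n, same_law P P U (Us n);
  ns_indep : mutual_indep P setT
    (fun i : option nat => if i is Some n then sigma_of (Us n) else sigma_of X);
  ns_YN : forall N, (0 < N)%N -> nested_Y F f X Us N \in Lfun P 2%:E;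
  ns_DY : forall N, (0 < N)%N -> DY (2 * N)%N \in Lfun P 2%:E;
  ns_EDY : forall N, (0 < N)%N -> ('E_P[DY (2 * N)%N] =
    'E_P[nested_Y F f X Us (2 * N) \- nested_Y F f X Us N])%E }.

(* (WE_{alpha,Rb}) with the coefficients c_1, ..., c_Rb and the remainder eta. *)
Definition weak_error (Y : T -> R) (YN : nat -> T -> R) (alpha : R) (Rb : nat)
    (c eta : nat -> R) : Prop :=
  eta N @[N --> \oo] --> 0 /\
  forall N, (0 < N)%N ->
    ('E_P[YN N] = 'E_P[Y] +
       (\sum_(1 <= r < Rb.+1) c r * N%:R `^ (- (alpha * r%:R))
        + N%:R `^ (- (alpha * Rb%:R)) * eta N)%:E)%E.

(* (Var_beta) with the constants V1 and sigma. *)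
Definition var_bound (YN DY : nat -> T -> R) (beta V1 sigma : R) : Prop :=
  [/\ 0 < V1, 0 < sigma
    & forall N, (0 < N)%N ->
       ('V_P[DY (2 * N)%N] <= (V1 * (2 * N)%:R `^ (- beta))%:E)%E /\
       ('V_P[YN N] <= (sigma ^+ 2)%:E)%E].

End Nested.

Inductive ml_kind := MLMC | ML2R.

Record ml_param (R : realType) := MLParam {
  pJ : R; pq : nat -> R; pK : R; pR : nat }.

Section Estimator.
Context (R : realType).
Implicit Types (theta : ml_param R) (alpha : R).

(* The ceiling of x for x >= 0. All arguments below are nonnegative, except that
   of the number of levels, which is positive for eps small. *)
Definition ceiln (x : R) : nat := absz (Num.ceil x).

Definition weight_w alpha (Rb i : nat) : R :=
  (-1) ^+ (Rb - i) *
  \prod_(1 <= j < Rb.+1 | j != i) `|1 - 2 `^ (alpha * (j%:R - i%:R))|^-1.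

Definition weight_W alpha (Rb r : nat) : R :=
  \sum_(r <= i < Rb.+1) weight_w alpha Rb i.

Definition weight_A (k : ml_kind) alpha (Rb r : nat) : R :=
  match k with MLMC => 1 | ML2R => weight_W alpha Rb r end.

Definition lev_K theta (r : nat) : nat := (ceiln (pK theta) * 2 ^ r.-1)%N.
Definition lev_J theta (r : nat) : nat := ceiln (pJ theta * pq theta r).

(* [Z r j] is the j-th copy at level r: of Y_{K_1} if r = 1, of
   Delta Y_{K_r} if 2 <= r <= R; j ranges over 0, ..., J_r - 1. *)
Definition estimator (T' : Type) (k : ml_kind) alpha theta
    (Z : nat -> nat -> T' -> R) : T' -> R :=
  fun w => (lev_J theta 1)%:R^-1 * \sum_(j < lev_J theta 1) Z 1%N j w +
    \sum_(2 <= r < (pR theta).+1)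
      weight_A k alpha (pR theta) r / (lev_J theta r)%:R *
      \sum_(j < lev_J theta r) Z r j w.

Definition indep_copies (d d' : measure_display) (T : measurableType d)
    (P : probability T R) (T' : measurableType d') (P' : probability T' R)
    (YN DY : nat -> T -> R) theta (Z : nat -> nat -> T' -> R) : Prop :=
  let used := [set rj : nat * nat |
    (1 <= rj.1 <= pR theta)%N /\ (rj.2 < lev_J theta rj.1)%N] in
  [/\ forall r j, used (r, j) -> measurable_fun setT (Z r j),
      forall r j, used (r, j) ->
        same_law P P' (if r == 1%N then YN (lev_K theta 1) else DY (lev_K theta r))
          (Z r j)
    & mutual_indep P' used (fun rj : nat * nat => sigma_of (Z rj.1 rj.2))].

(* E[(I - Ihat)^2], the number I being E[Y]. *)
Definition mse (d d' : measure_display) (T : measurableType d)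
    (P : probability T R) (T' : measurableType d') (P' : probability T' R)
    (Y : T -> R) (Ihat : T' -> R) : \bar R :=
  'E_P'[fun w => (fine 'E_P[Y] - Ihat w) ^+ 2].

Definition cost (tau : R) theta : R :=
  pJ theta * \sum_(1 <= r < (pR theta).+1) pq theta r * (tau + (lev_K theta r)%:R).

Definition log2 (x : R) : R := ln x / ln 2.

(* In all the closed forms below, [ct > 0] is |c_1| in the MLMC case and the
   constant ctilde in the ML2R case, and [Ku] is the integer underlined K. *)
Definition opt_R (k : ml_kind) (alpha ct : R) (Ku : nat) (eps : R) : nat :=
  match k with
  | MLMC => ceiln (1 + log2 (ct `^ alpha^-1 / Ku%:R)
              + alpha^-1 * log2 (Num.sqrt (1 + 2 * alpha) * eps^-1))
  | ML2R => let b := 2^-1 + log2 (ct `^ alpha^-1 / Ku%:R) in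
      ceiln (b + Num.sqrt (b ^+ 2
               + 2 / alpha * log2 (eps^-1 * Num.sqrt (1 + 4 * alpha))))
  end.

Definition opt_Kplus (k : ml_kind) (alpha ct : R) (Rb : nat) (eps : R) : R :=
  match k with
  | MLMC => (1 + 2 * alpha) `^ (2 * alpha)^-1 * eps `^ (- alpha^-1)
            * ct `^ alpha^-1 * 2 `^ (- (Rb%:R - 1))
  | ML2R => (1 + 2 * alpha * Rb%:R) `^ (2 * alpha * Rb%:R)^-1
            * eps `^ (- (alpha * Rb%:R)^-1)
            * ct `^ alpha^-1 * 2 `^ (- ((Rb%:R - 1) / 2))
  end.

Definition opt_M (k : ml_kind) (alpha : R) (Rb : nat) : R :=
  match k with
  | MLMC => 1 + (2 * alpha)^-1
  | ML2R => 1 + (2 * alpha * Rb%:R)^-1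
  end.

Section Closed_form.
Context (k : ml_kind) (alpha beta V1 sigma ct : R) (Ku : nat).

(* q_r before normalization by mu *)
Definition opt_q0 (Rb r : nat) : R :=
  if r == 1%N then sigma else
  Num.sqrt V1 * `|weight_A k alpha Rb r|
  / (Ku%:R `^ (beta / 2) * 2 `^ ((1 + beta) * (r%:R - 1) / 2)).

Definition opt_mu (Rb : nat) : R := \sum_(1 <= r < Rb.+1) opt_q0 Rb r.

Definition opt_q (Rb r : nat) : R :=
  if (1 <= r <= Rb)%N then opt_q0 Rb r / opt_mu Rb else 0.

Definition opt_K (eps : R) : R :=
  Ku%:R * (ceiln (opt_Kplus k alpha ct (opt_R k alpha ct Ku eps) eps / Ku%:R))%:R.

(* For isolated alpha some weight W_r^R may vanish; then q_r = 0 and, since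
   x / 0 = 0, level r contributes 0 to J and to the estimator. *)
Definition opt_J (eps : R) : R :=
  let Rb := opt_R k alpha ct Ku eps in
  opt_M k alpha Rb / eps ^+ 2 *
  (sigma ^+ 2 / opt_q Rb 1 +
   \sum_(2 <= r < Rb.+1) weight_A k alpha Rb r ^+ 2 * V1 /
     (opt_q Rb r * opt_K eps `^ beta * 2 `^ ((r%:R - 1) * beta))).

Definition theta_eps (eps : R) : ml_param R :=
  MLParam (opt_J eps) (opt_q (opt_R k alpha ct Ku eps)) (opt_K eps)
    (opt_R k alpha ct Ku eps).

End Closed_form.

(* K sum_r q_r 2^(r-1) *)
Definition mean_inner_cost theta : R :=
  pK theta * \sum_(1 <= r < (pR theta).+1) pq theta r * 2 ^+ r.-1.

Definition cost_factor (beta tau dinf : R) : R :=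
  if beta <= 1 then 1 else tau / dinf + 1.

Definition rate (k : ml_kind) (alpha beta eps : R) : R :=
  if 1 < beta then eps ^+ 2 else
  match k with
  | MLMC => if beta == 1 then eps ^+ 2 * (ln (eps^-1) ^+ 2)^-1
            else eps `^ (2 + (1 - beta) / alpha)
  | ML2R => if beta == 1 then eps ^+ 2 * (ln (eps^-1))^-1
            else eps ^+ 2 * expR (- ((1 - beta) / Num.sqrt alpha
                                     * Num.sqrt (2 * ln (eps^-1) * ln 2)))
  end.

(* limsup as eps -> 0+ *)
Definition limsup0 (g : R -> \bar R) : \bar R := limf_esup g (0 : R)^'+.

End Estimator.

(* Main.v *)
Require Import Defs.
From HB Require Import structures.
From mathcomp Require Import all_boot all_order all_algebra.
From mathcomp Require Import all_classical all_reals all_analysis.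
From mathcomp Require Import measurable_realfun.
From mathcomp Require Import ring lra zify.
Import Order.TTheory GRing.Theory Num.Theory.
Import numFieldNormedType.Exports.
Local Open Scope classical_set_scope.
Local Open Scope ring_scope.

Set Implicit Arguments.
Unset Strict Implicit.
Unset Printing Implicit Defensive.

(** Since [sum_r q_r = 1], the cost is [J (tau + d)] with [d] the mean inner cost
    [K sum_r q_r 2^(r-1)], so that
    [cost tau = (tau / d + 1) * cost 0].  For [beta <= 1] the number of levels
    tends to infinity and [d] diverges with it, for [beta > 1] it stays between
    two positive constants; this compares the two limsups.  The closed form of
    [J] gives [cost tau <= C (sum_(k < R) 2^(k (1 - beta) / 2))^2 / eps^2], and
    the growth of [R(eps)] turns this into the rates.

    For the mean square error, [J] is chosen so that the variance is at most
    [eps^2 / M].  The bias telescopes: for MLMC only the finest level remains;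
    for ML2R, summation by parts leaves [sum_i w_i E[Y_(K 2^(i-1))]], and the
    [w_i] are the Lagrange weights at 0 for the nodes [2^(- alpha (i-1))], which
    kill every term of the expansion but the one of order [R] and its
    remainder. *)

(** * Moments of products and linear combinations of independent variables *)

Section Independence.
Context (R : realType) (d : measure_display) (T : measurableType d)
  (P : probability T R).
Implicit Types X Y : T -> R.

(** The constants of the closed form share out the error: the variance receives eps^2 / M, and K^+
    is the value of K at which the squared leading bias of MLMC is the missing share 1 - 1 / M = 1 /
    (1 + 2 alpha) of eps^2. For ML2R the analogous factor (1 + 2 alpha R)^(-1/2) tends to 0, so a
    bias controlled only up to a constant multiple is still negligible against eps.

    Two obstacles shape the ML2R case. The choice of K leaves a factor ctilde^(-R) in the bias, so
    c_R + eta_R has to be O(ctilde^R). Boundedness of eta_R gives this when ctilde >= 1; when ctilde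
    < 1 the decay is extracted from the comparison of the expansions of consecutive orders, which
    contracts for N > 1 only, whence the extra assumption on eta_R(1) when the integer underlined K
    is 1. Moreover K(eps) is only bracketed between Ku and 2 Ku near 0, so for beta > 1 the mean
    inner cost is bounded without a limit being established; its lower limit takes the place of
    d_infinity, at the price of v >= 0. *)

Lemma Lfun_measurable (p : \bar R) X : X \in Lfun P p -> measurable_fun setT X.
Proof. by rewrite inE => /andP[/[!inE]]. Qed.

Lemma Lfun12 X : X \in Lfun P 2%:E -> X \in Lfun P 1.
Proof. exact/Lfun_subset12/fin_num_measure. Qed.

(** Independence says that the law of the pair and the product of the two laws agree on rectangles,
    hence everywhere by uniqueness of the product measure; Fubini then factors the integral of x
    y. *)
Lemma indep_expectationM X Y :
  X \in Lfun P 2%:E -> Y \in Lfun P 2%:E -> indep_rv P X Y ->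
  'E_P[X \* Y]%E = ('E_P[X] * 'E_P[Y])%E.
Proof.
move=> LX LY XY.
have mX : measurable_fun setT (X : T -> measurableTypeR R) := Lfun_measurable LX.
have mY : measurable_fun setT (Y : T -> measurableTypeR R) := Lfun_measurable LY.
have iX : P.-integrable setT (EFin \o X) by apply/Lfun1_integrable/Lfun12.
have iY : P.-integrable setT (EFin \o Y) by apply/Lfun1_integrable/Lfun12.
pose X' : {mfun T >-> measurableTypeR R} := @mfun_Sub _ _ T (measurableTypeR R) X (mem_set mX).
pose Y' : {mfun T >-> measurableTypeR R} := @mfun_Sub _ _ T (measurableTypeR R) Y (mem_set mY).
have mZ : measurable_fun setT
    (fun w => (X w, Y w) : measurableTypeR R * measurableTypeR R)%type by apply: measurable_fun_pair.
pose Z : {mfun T >-> (measurableTypeR R * measurableTypeR R)%type} := @mfun_Sub _ _ T (measurableTypeR R * measurableTypeR R)%type _ (mem_set mZ).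
pose f (z : measurableTypeR R * measurableTypeR R) : \bar R := (z.1 * z.2)%:E.
have mf : measurable_fun setT f.
  by apply/measurable_EFinP; apply: measurable_funM.
have law A : measurable A ->
    (distribution P X' \x distribution P Y')%E A = distribution P Z A.
  by apply: product_measure_unique => B C mB mC; rewrite /= /pushforward -XY.
have ifZ : P.-integrable setT (f \o Z).
  exact/(Lfun1_integrable P (X \* Y))/Lfun2_mul_Lfun1.
have iff : (distribution P X' \x distribution P Y')%E.-integrable setT f.
  apply/integrableP; split=> //.
  rewrite (@eq_measure_integral _ _ _ _ (distribution P Z)); last first.
    by move=> A mA _; exact: law.
  have /integrableP[_] : (distribution P Z).-integrable setT f.
    exact: integrable_pushforward.
  by [].
have -> : 'E_P[X \* Y]%E = (\int[distribution P X' \x distribution P Y']_z f z)%E.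
  rewrite (@eq_measure_integral _ _ _ _ (distribution P Z)); last first.
    by move=> A mA _; exact: law.
  by rewrite integral_distribution// unlock.
rewrite -integral12_prod_meas1//= /fubini_F.
have EY x : (\int[distribution P Y']_y f (x, y) = x%:E * 'E_P[Y])%E.
  rewrite unlock -integralZl//.
  rewrite (@integral_distribution _ _ _ _ _ P Y'
    (fun y : measurableTypeR R => (x * y)%:E))//.
  - by apply/measurable_EFinP; exact: measurable_funM.
  - exact: (integrableZl measurableT x iY).
under eq_integral do rewrite EY.
have -> : ('E_P[Y] = (fine 'E_P[Y])%:E)%E.
  by rewrite fineK// expectation_fin_num// Lfun12.
set c := fine _; rewrite [in RHS]unlock -integralZr//.
apply: (@integral_distribution _ _ _ _ _ P X' (fun x : measurableTypeR R => (x * c)%:E)).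
- by apply/measurable_EFinP; exact: measurable_funM.
- exact: (integrableZr measurableT c iX).
Qed.

Lemma indep_covariance0 X Y :
  X \in Lfun P 2%:E -> Y \in Lfun P 2%:E -> indep_rv P X Y ->
  covariance P X Y = 0%E.
Proof.
move=> LX LY XY.
have LXY : (X * Y)%R \in Lfun P 1 by exact: (Lfun2_mul_Lfun1 LX LY).
rewrite (covarianceE (Lfun12 LX) (Lfun12 LY) LXY).
by rewrite (indep_expectationM LX LY XY) subee// fin_numM// expectation_fin_num// Lfun12.
Qed.

Lemma Lfun_sum (I : Type) (s : seq I) (a : I -> R) (Z : I -> T -> R) :
  (forall i, Z i \in Lfun P 2%:E) ->
  (fun w => \sum_(i <- s) a i * Z i w) \in Lfun P 2%:E.
Proof.
move=> LZ.
elim: s => [|i s IH].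
  rewrite (_ : (fun _ => _) = cst 0); first exact: Lfun_cst.
  by apply/funext => w; rewrite big_nil.
rewrite (_ : (fun _ => _) =
  (a i \o* Z i) \+ (fun w => \sum_(i <- s) a i * Z i w)); last first.
  by apply/funext => w; rewrite big_cons /= mulrC.
have le12 : (1 <= 2%:E :> \bar R)%E by rewrite lee_fin ler1n.
have [_ addL] := Lfun_addr_closed P le12.
by apply: addL => //; rewrite Lfun_scale// ler1n.
Qed.

Lemma expectation_lincomb (I : Type) (s : seq I) (a m : I -> R)
    (Z : I -> T -> R) :
  (forall i, Z i \in Lfun P 2%:E) -> (forall i, 'E_P[Z i] = (m i)%:E)%E ->
  ('E_P[fun w => (\sum_(i <- s) a i * Z i w)%R] = (\sum_(i <- s) a i * m i)%:E)%E.
Proof.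
move=> LZ EZ; elim: s => [|i s IH].
  rewrite big_nil (_ : (fun _ => _) = cst 0) ?expectation_cst//.
  by apply/funext => w; rewrite big_nil.
rewrite (_ : (fun _ => _) =
  (a i \o* Z i) \+ (fun w => \sum_(i <- s) a i * Z i w)); last first.
  by apply/funext => w; rewrite big_cons /= mulrC.
rewrite expectationD ?IH ?expectationZl ?EZ ?Lfun12 ?Lfun_sum//.
  by rewrite big_cons EFinD EFinM.
by rewrite Lfun_scale// ler1n.
Qed.

(** Induction on the list: the covariance of the head with the remaining sum vanishes term by term.
    Only upper bounds on the variances are assumed, which is what [var_bound] provides. *)
Lemma variance_lincomb (I : eqType) (s : seq I) (a v : I -> R)
    (Z : I -> T -> R) : uniq s ->
  (forall i, Z i \in Lfun P 2%:E) ->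
  (forall i, i \in s -> ('V_P[Z i] <= (v i)%:E)%E) ->
  (forall i j, i \in s -> j \in s -> i != j -> indep_rv P (Z i) (Z j)) ->
  ('V_P[fun w => (\sum_(i <- s) a i * Z i w)%R] <=
   (\sum_(i <- s) a i ^+ 2 * v i)%:E)%E.
Proof.
move=> + LZ VZ; elim: s VZ => [|i s IH] VZ.
  move=> _ _; rewrite big_nil (_ : (fun _ => _) = cst 0) ?variance_cst//.
  by apply/funext => w; rewrite big_nil.
move=> /= /andP[iNs us] indep.
have L1 : (a i \o* Z i) \in Lfun P 2%:E by rewrite Lfun_scale// ler1n.
have cov0 : covariance P (a i \o* Z i) (fun w => \sum_(i <- s) a i * Z i w) = 0%E.
  (* The inner induction runs over sublists [t] of [s], so that the head stays outside [s] while [t]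
     shrinks. *)
  have : {subset s <= s} by [].
  move: {1 3}s => t; elim: t => [|j t IHt] ts.
    rewrite (_ : (fun _ => \sum_(_ <- _) _) = cst 0) ?covariance_cst_r//.
    by apply/funext => w; rewrite big_nil.
  rewrite (_ : (fun w => \sum_(_ <- _ :: _) _) =
    (a j \o* Z j) \+ (fun w => \sum_(i <- t) a i * Z i w)); last first.
    by apply/funext => w; rewrite big_cons /= mulrC.
  rewrite covarianceDr//; last 2 first.
  - by rewrite Lfun_scale// ler1n.
  - exact: Lfun_sum.
  rewrite IHt ?adde0; last by move=> k kt; apply: ts; rewrite inE kt orbT.
  have js : j \in s by apply: ts; rewrite inE eqxx.
  have ij : i != j by apply: contraNneq iNs => ->.
  have Lj : a j \o* Z j \in Lfun P 2%:E by rewrite Lfun_scale// ler1n.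
  have Lij : (Z i * Z j)%R \in Lfun P 1 by exact: (Lfun2_mul_Lfun1 (LZ i) (LZ j)).
  have Lij' : (Z i * (a j \o* Z j))%R \in Lfun P 1.
    by exact: (Lfun2_mul_Lfun1 (LZ i) Lj).
  rewrite (covarianceZl _ (Lfun12 (LZ i)) (Lfun12 Lj) Lij').
  rewrite (covarianceZr _ (Lfun12 (LZ i)) (Lfun12 (LZ j)) Lij).
  have iZ : indep_rv P (Z i) (Z j) by apply: indep; rewrite // inE ?eqxx ?js ?orbT.
  by rewrite indep_covariance0 ?mule0.
rewrite (_ : (fun _ => _) =
  (a i \o* Z i) \+ (fun w => \sum_(i <- s) a i * Z i w)); last first.
  by apply/funext => w; rewrite big_cons /= mulrC.
rewrite varianceD ?Lfun_sum// cov0 mule0 adde0 varianceZ//.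
rewrite big_cons EFinD (EFinM (a i ^+ 2) (v i)) leeD//.
  by rewrite lee_wpmul2l ?lee_fin ?sqr_ge0// VZ// inE eqxx.
apply: IH => // [j js|j k js ks].
  by rewrite VZ// inE js orbT.
by apply: indep; rewrite inE ?js ?ks orbT.
Qed.

(** Bias-variance decomposition, from the invariance of the variance under [c - _]. *)
Lemma mse_le (Ihat : T -> R) (c m v : R) : Ihat \in Lfun P 2%:E ->
  'E_P[Ihat]%E = m%:E -> ('V_P[Ihat] <= v%:E)%E ->
  ('E_P[fun w => ((c - Ihat w) ^+ 2)%R] <= ((c - m) ^+ 2 + v)%:E)%E.
Proof.
move=> LI EI VI.
have LcI : (cst c \- Ihat) \in Lfun P 2%:E.
  by rewrite rpredB ?lee1n//= Lfun_cst.
have EcI : ('E_P[cst c \- Ihat] = (c - m)%:E)%E.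
  by rewrite expectationB ?Lfun12 ?Lfun_cst//= expectation_cst EI.
have := varianceE LcI.
rewrite EcI varianceB_cst_l// => VE.
have -> : ('E_P[fun w => ((c - Ihat w) ^+ 2)%R] = ((c - m) ^+ 2)%:E + 'V_P[Ihat])%E.
  by rewrite VE EFin_expe [RHS]addeC subeK// fin_numX.
by rewrite EFinD leeD2l.
Qed.

End Independence.

(** * Transfer of integrals and moments between variables with the same law *)

Section SameLaw.
Context (R : realType) (d d' : measure_display) (T : measurableType d)
  (P : probability T R) (T' : measurableType d') (P' : probability T' R).
Variables (X : T -> R) (X' : T' -> R).
Hypotheses (mX : measurable_fun setT X) (mX' : measurable_fun setT X')
  (XX' : same_law P P' X X').

(** Both sides are the integral of [g] against the common image measure; integrable functions follow
    by positive and negative parts. *)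
Lemma same_law_ge0_integral (g : R -> \bar R) : measurable_fun setT g ->
  (forall x, 0 <= g x)%E ->
  (\int[P]_w g (X w) = \int[P']_w g (X' w))%E.
Proof.
move=> mg g0.
pose Y : {mfun T >-> measurableTypeR R} :=
  @mfun_Sub _ _ T (measurableTypeR R) X (mem_set mX).
pose Y' : {mfun T' >-> measurableTypeR R} :=
  @mfun_Sub _ _ T' (measurableTypeR R) X' (mem_set mX').
transitivity (\int[distribution P Y]_x g x)%E.
  by rewrite ge0_integral_distribution.
rewrite (@eq_measure_integral _ _ _ _ (distribution P' Y')); last first.
  by move=> A mA _; exact: XX'.
by rewrite ge0_integral_distribution.
Qed.

Lemma same_law_integral (g : R -> R) : measurable_fun setT g ->
  P.-integrable setT (fun w => (g (X w))%:E) ->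
  P'.-integrable setT (fun w => (g (X' w))%:E) /\
  (\int[P]_w (g (X w))%:E = \int[P']_w (g (X' w))%:E)%E.
Proof.
move=> mg /integrableP[mgX igX]; split.
  apply/integrableP; split.
    by apply/measurable_EFinP; apply: (measurableT_comp mg).
  rewrite -(@same_law_ge0_integral (fun x => `|(g x)%:E|%E))//.
  by apply: measurableT_comp => //; exact/measurable_EFinP.
rewrite integralE [RHS]integralE.
have gp : measurable_fun setT (EFin \o g)^\+%E.
  by apply: measurable_funepos; exact/measurable_EFinP.
have gn : measurable_fun setT (EFin \o g)^\-%E.
  by apply: measurable_funeneg; exact/measurable_EFinP.
have Ep := same_law_ge0_integral gp (fun x => funepos_ge0 _ x).
have En := same_law_ge0_integral gn (fun x => funeneg_ge0 _ x).
change (fun w => (g (X w))%:E) with ((EFin \o g) \o X).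
change (fun w => (g (X' w))%:E) with ((EFin \o g) \o X').
rewrite (funepos_comp (EFin \o g) X) (funepos_comp (EFin \o g) X').
rewrite (funeneg_comp (EFin \o g) X) (funeneg_comp (EFin \o g) X').
by congr (_ - _)%E; [exact: Ep|exact: En].
Qed.

Lemma same_law_Lfun2 : X \in Lfun P 2%:E -> X' \in Lfun P' 2%:E.
Proof.
move=> LX; have /Lfun2_integrable_sqr iX := LX.
have [|iX' _] := @same_law_integral (fun x => x ^+ 2) _ iX.
  by apply: measurable_funX.
rewrite inE; apply/andP; split; rewrite inE//=.
have /integrableP[_] := iX'.
rewrite /finite_norm unlock /= => h.
apply: poweR_lty; apply: le_lt_trans h.
rewrite ge0_le_integral//.
- apply/measurable_EFinP.
  apply/(@measurableT_comp _ _ _ _ _ _ (fun x : R => x `^ 2)%R) => //.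
  exact/measurableT_comp.
- apply/measurable_EFinP; apply: measurableT_comp => //.
  exact: measurable_funX.
- by move=> t _ /=; rewrite lee_fin normrX powR_mulrn.
Qed.

Lemma same_law_expectation : X \in Lfun P 2%:E ->
  ('E_P[X] = 'E_P'[X'])%E.
Proof.
move=> LX; rewrite unlock.
have iX : P.-integrable setT (fun w => (X w)%:E).
  exact/(Lfun1_integrable P X)/Lfun12.
by have [] := @same_law_integral id _ iX.
Qed.

Lemma same_law_variance : X \in Lfun P 2%:E ->
  ('V_P[X] = 'V_P'[X'])%E.
Proof.
move=> LX; rewrite !varianceE// ?same_law_Lfun2// same_law_expectation//.
congr (_ - _)%E; rewrite unlock.
have /Lfun2_integrable_sqr iX := LX.
have [|_] := @same_law_integral (fun x => x ^+ 2) _ iX => //.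
Qed.

End SameLaw.

(** * Mean square error of the multilevel estimator in terms of level means and variances *)

Section EstimatorError.
Context (R : realType) (d d' : measure_display) (T : measurableType d)
  (P : probability T R) (T' : measurableType d') (P' : probability T' R).

Lemma mutual_indep_pair (I : eqType) (D : set I) (Z : I -> T' -> R) (i j : I) :
  mutual_indep P' D (fun k => sigma_of (Z k)) -> D i -> D j -> i != j ->
  indep_rv P' (Z i) (Z j).
Proof.
move=> ind Di Dj ij A B mA mB.
pose C k := if k == i then Z i @^-1` A else Z j @^-1` B.
have := ind [:: i; j] C.
rewrite /= inE ij => /(_ isT) H.
have Ci : C i = Z i @^-1` A by rewrite /C eqxx.
have Cj : C j = Z j @^-1` B by rewrite /C eq_sym (negbTE ij).
have -> : Z i @^-1` A `&` Z j @^-1` B = \bigcap_(k in [set` [:: i; j]]) C k.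
  rewrite -Ci -Cj; apply/seteqP; split=> [w [Ciw Cjw] k /=|w Cw].
    by rewrite !inE => /orP[] /eqP ->.
  by split; apply: Cw; rewrite /= !inE eqxx ?orbT.
rewrite {}H; first by rewrite !big_cons big_nil mule1 Ci Cj.
move=> k; rewrite !inE => /orP[] /eqP ->; split => //.
- by exists A => //; rewrite setTI Ci.
- by exists B => //; rewrite setTI Cj.
Qed.

(** The estimator is one linear combination over the pairs (r, j) of independent variables, with
    coefficient B_r / J_r. The last hypothesis covers a level without samples: its average is 0 by
    the convention on division, which is unbiased only if its weight vanishes. *)
Lemma mse_estimator_le (k : ml_kind) (alpha : R) (theta : ml_param R)
    (Y : T -> R) (YN DY : nat -> T -> R) (Z : nat -> nat -> T' -> R)
    (m v : nat -> R) :
  let B r := if r == 1%N then 1 else weight_A k alpha (pR theta) r in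
  let V r := if r == 1%N then YN (lev_K theta 1) else DY (lev_K theta r) in
  indep_copies P P' YN DY theta Z ->
  (0 < pR theta)%N ->
  (forall r, (1 <= r <= pR theta)%N ->
    [/\ V r \in Lfun P 2%:E, ('E_P[V r] = (m r)%:E)%E &
     ('V_P[V r] <= (v r)%:E)%E]) ->
  (forall r, (1 <= r <= pR theta)%N -> lev_J theta r = 0%N -> B r = 0) ->
  (mse P P' Y (estimator k alpha theta Z) <=
   ((fine 'E_P[Y] - \sum_(1 <= r < (pR theta).+1) B r * m r) ^+ 2 +
    \sum_(1 <= r < (pR theta).+1) B r ^+ 2 * v r / (lev_J theta r)%:R)%R%:E)%E.
Proof.
move=> B V [mZ lawZ indZ] R0 HV HB.
pose s := [seq (r, j) | r <- index_iota 1 (pR theta).+1,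
                        j <- index_iota 0 (lev_J theta r)].
have sP i : i \in s -> (1 <= i.1 <= pR theta)%N /\ (i.2 < lev_J theta i.1)%N.
  by case/allpairsPdep => r [j [+ + ->]]; rewrite !mem_index_iota.
have us : uniq s.
  apply: allpairs_uniq_dep; first exact: iota_uniq.
    by move=> r _; exact: iota_uniq.
  by move=> [r j] [r' j'] _ _ /= [-> ->].
(* The family is extended by the constant 0 outside [s], because the moment lemmas require every
   member to be square integrable. *)
pose Z' i := if i \in s then Z i.1 i.2 else cst 0.
pose m' i := if i \in s then m i.1 else 0.
pose a (i : nat * nat) := B i.1 / (lev_J theta i.1)%:R.
have lawZ' i : i \in s -> same_law P P' (V i.1) (Z i.1 i.2).
  by move=> /sP ?; exact: lawZ.
have mZ' i : i \in s -> measurable_fun setT (Z i.1 i.2).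
  by move=> /sP ?; exact: mZ.
have LZ' i : Z' i \in Lfun P' 2%:E.
  rewrite /Z'; case: ifPn => [si|_]; last exact: Lfun_cst.
  have [LV _ _] := HV _ (sP _ si).1.
  exact: (same_law_Lfun2 (Lfun_measurable LV) (mZ' i si) (lawZ' i si) LV).
have EZ' i : ('E_P'[Z' i] = (m' i)%:E)%E.
  rewrite /Z' /m'; case: ifPn => [si|_]; last exact: expectation_cst.
  have [LV <- _] := HV _ (sP _ si).1.
  by rewrite -(same_law_expectation (Lfun_measurable LV) (mZ' i si) (lawZ' i si) LV).
have VZ' i : i \in s -> ('V_P'[Z' i] <= (v i.1)%:E)%E.
  move=> si; rewrite /Z' si; have [LV _ VV] := HV _ (sP _ si).1.
  by rewrite -(same_law_variance (Lfun_measurable LV) (mZ' i si) (lawZ' i si) LV).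
have iZ' i j : i \in s -> j \in s -> i != j -> indep_rv P' (Z' i) (Z' j).
  move=> si sj ij; rewrite /Z' si sj.
  have := @mutual_indep_pair _ _ (fun i => Z i.1 i.2) i j indZ.
  by apply => //; exact: sP.
have sumE (F : nat -> nat -> R) : \sum_(i <- s) F i.1 i.2 =
    \sum_(1 <= r < (pR theta).+1) \sum_(j < lev_J theta r) F r j.
  by rewrite big_allpairs_dep; apply: eq_bigr => r _; rewrite big_mkord.
have -> : estimator k alpha theta Z = fun w => \sum_(i <- s) a i * Z' i w.
  apply/funext => w.
  rewrite (eq_big_seq (fun i => B i.1 / (lev_J theta i.1)%:R * Z i.1 i.2 w));
    last by move=> i si; rewrite /a /Z' si.
  rewrite (sumE (fun r j => B r / (lev_J theta r)%:R * Z r j w)) big_ltn//.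
  rewrite /estimator; congr (_ + _).
    by rewrite /B eqxx mulr_sumr; apply: eq_bigr => j _; rewrite mul1r.
  apply: eq_big_nat => r /andP[r2 _].
  by rewrite mulr_sumr /B gtn_eqF.
rewrite /mse; apply: mse_le.
- exact: Lfun_sum.
- rewrite (expectation_lincomb _ _ LZ' EZ'); congr (_%:E).
  rewrite (eq_big_seq (fun i => B i.1 / (lev_J theta i.1)%:R * m i.1));
    last by move=> i si; rewrite /a /m' si.
  rewrite (sumE (fun r j => B r / (lev_J theta r)%:R * m r)).
  apply: eq_big_nat => r r1R.
  rewrite sumr_const card_ord -[LHS]mulr_natr.
  have [J0|J0] := eqVneq (lev_J theta r) 0%N.
    by rewrite HB// J0 mulr0 mul0r.
  by rewrite mulrAC divfK// pnatr_eq0.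
- apply: (le_trans (variance_lincomb a us LZ' VZ' iZ')).
  rewrite lee_fin (sumE (fun r j => (B r / (lev_J theta r)%:R) ^+ 2 * v r)).
  apply: ler_sum_nat => r r1R.
  rewrite sumr_const card_ord -[leLHS]mulr_natr.
  have [J0|J0] := eqVneq (lev_J theta r) 0%N.
    by rewrite HB// J0 mulr0 expr2 !mul0r.
  have {}J0 : (lev_J theta r)%:R != 0 :> R by rewrite pnatr_eq0.
  by rewrite le_eqVlt; apply/orP; left; apply/eqP; field.
Qed.

End EstimatorError.

(** Lagrange interpolation evaluated at 0. The interpolant minus [p] has size at most [size s] and
    vanishes at all the points of [s], so it is zero. *)
Lemma interpolation_at0 (K : fieldType) (s : seq K) (p : {poly K}) :
  uniq s -> (size p <= size s)%N ->
  \sum_(a <- s) p.[a] * \prod_(b <- s | b != a) (b / (b - a)) = p.[0].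
Proof.
move=> us ps.
pose l a : {poly K} := \prod_(b <- rem a s) ('X - b%:P).
have lE a c : (l a).[c] = \prod_(b <- s | b != a) (c - b).
  rewrite horner_prod rem_filter// big_filter; apply: eq_bigr => b _.
  by rewrite hornerXsubC.
have laa a : (l a).[a] != 0.
  rewrite lE prodf_seq_neq0; apply/allP => b _; apply/implyP => ba.
  by rewrite subr_eq0 eq_sym.
have lac a c : c \in s -> c != a -> (l a).[c] = 0.
  move=> cs ca; rewrite lE big_mkcond (big_rem c)//= ca subrr mul0r//.
pose q := \sum_(a <- s) (p.[a] / (l a).[a]) *: l a - p.
have q0 : q = 0.
  apply/eqP; apply: contraTT ps => qn0; rewrite -ltnNge.
  have : (size s < size q)%N.
    apply: max_poly_roots => //; apply/allP => c cs.
    rewrite /root /q hornerD hornerN horner_sum (big_rem c)//= hornerZ divfK//.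
    rewrite big_seq big1 ?addr0 ?subrr// => a; rewrite mem_rem_uniq// inE.
    by move=> /andP[ac _]; rewrite hornerZ (lac a c cs) ?mulr0 1?eq_sym.
  move=> sq; rewrite ltnNge; apply: contraTN sq => ps; rewrite -leqNgt.
  apply: (leq_trans (size_polyD _ _)); rewrite geq_max size_polyN ps andbT.
  apply: (leq_trans (size_sum _ _ _)); apply/bigmax_leqP_seq => a as_ _.
  apply: (leq_trans (size_scale_leq _ _)); rewrite size_prod_XsubC size_rem//.
  by rewrite prednK//; case: (s) as_.
have : q.[0] = 0 by rewrite q0 horner0.
rewrite /q hornerD hornerN horner_sum => /eqP; rewrite subr_eq0 => /eqP <-.
apply: eq_bigr => a _; rewrite hornerZ -mulrA; congr (_ * _).
rewrite !lE mulrC -prodf_div; apply: eq_bigr => b _.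
by rewrite sub0r -[b - a]opprB invrN mulrN mulNr.
Qed.

(** * Real powers, and bounds for products and geometric sums *)

Section PowR.
Context (R : realType).
Implicit Types a x y : R.

Lemma powR_expR a x : 0 < a -> a `^ x = expR (x * ln a).
Proof. by move=> a0; rewrite /powR gt_eqF. Qed.

Lemma powRD_gt0 a x y : 0 < a -> a `^ (x + y) = a `^ x * a `^ y.
Proof. by move=> a0; rewrite powRD// (gt_eqF a0) implybT. Qed.

Lemma powR2_lt1 x : x < 0 -> 2 `^ x < 1 :> R.
Proof. by move=> x0; rewrite powR_expR// expR_lt1 pmulr_llt0// ln_gt0// ltr1n. Qed.

Lemma expR_ge_prod (I : Type) (s : seq I) (u : I -> R) :
  (forall i, 0 <= u i) -> \prod_(i <- s) (1 + u i) <= expR (\sum_(i <- s) u i).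
Proof.
move=> u0; rewrite expR_sum.
by apply: ler_prod => i _; rewrite expR_ge1Dx addr_ge0.
Qed.

Lemma geometric_sum_le y m n : 0 <= y < 1 -> \sum_(m <= k < n) y ^+ k <= (1 - y)^-1.
Proof.
move=> /andP[y0 y1].
have h : 0 < 1 - y by rewrite subr_gt0.
have [nm|mn] := leqP n m; first by rewrite big_geq// invr_ge0 ltW.
rewrite -(ler_pM2l h) mulfV ?gt_eqF//.
have E : 1 - y ^+ n = (1 - y) * \sum_(i < n) y ^+ i.
  by rewrite -opprB subrX1 -mulNr opprB.
apply: (@le_trans _ _ (1 - y ^+ n)); last by rewrite lerBlDr lerDl exprn_ge0.
rewrite E ler_pM2l// -(big_mkord predT (fun k => y ^+ k)) (@big_cat_nat _ _ _ m 0)//=.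
  by rewrite lerDr sumr_ge0// => *; rewrite exprn_ge0.
exact: ltnW.
Qed.

End PowR.

(** * The ML2R weights: closed form, decay, moments, and limit of the W_r *)

Section Weights.
Context (R : realType) (alpha : R).
Hypothesis alpha_gt0 : 0 < alpha.

Let y : R := 2 `^ (- alpha).

Let y_gt0 : 0 < y. Proof. exact: powR_gt0. Qed.

Let y_lt1 : y < 1. Proof. by rewrite powR2_lt1// oppr_lt0. Qed.

Let y_ge0 : 0 <= y. Proof. exact: ltW. Qed.

Let y_neq1 : y != 1. Proof. by rewrite lt_eqF. Qed.

Let yn_gt0 n : 0 < y ^+ n. Proof. exact: exprn_gt0. Qed.

Let yn_le1 n : y ^+ n <= 1. Proof. by rewrite exprn_ile1// ltW. Qed.

Let yn_lt1 n : y ^+ n.+1 < 1. Proof. by rewrite exprn_ilt1. Qed.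

Lemma powR2_node i j : 2 `^ (alpha * (j%:R - i%:R)) = y ^+ i / y ^+ j.
Proof.
rewrite -!powR_mulrn// -!powRrM -powRN -powRD_gt0//.
by congr (_ `^ _); ring.
Qed.

(** The reciprocal of the q-Pochhammer symbol (y; y)_n; it is bounded in n because y < 1. *)
Let G n : R := \prod_(1 <= k < n.+1) (1 - y ^+ k)^-1.

(** The product splits at j = i. The indices j < i give 1 / (1 - y^(i-j)), hence [G i.-1]. For j = i
    + k the factor is 1 / (y^(-k) - 1) = y^k / (1 - y^k), which gives [G (Rb - i)] and the exponent
    1 + ... + (Rb - i). *)
Lemma weight_wE Rb i : (1 <= i <= Rb)%N ->
  weight_w alpha Rb i = (-1) ^+ (Rb - i) * G i.-1 * G (Rb - i) * y ^+ 'C((Rb - i).+1, 2).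
Proof.
move=> /andP[i1 iR]; rewrite /weight_w -!mulrA; congr (_ * _).
rewrite (@big_cat_nat _ _ _ i 1)//=; last exact: leqW.
rewrite (@big_ltn_cond _ _ _ i)// eqxx /=; congr (_ * _).
  case: i i1 iR => // i _ iR.
  rewrite [RHS]big_nat_rev /= big_nat_cond [RHS]big_nat.
  apply: eq_big => [j|j /andP[/andP[j1 ji] _]].
    by rewrite andbC; case: eqVneq => // ->; rewrite ltnn andbF.
  rewrite powR2_node -expfB_cond ?(gt_eqF y_gt0)//; last by rewrite ltnW.
  rewrite gtr0_norm ?add1n.
    by [].
  by rewrite subr_gt0 exprn_ilt1// -lt0n subn_gt0.
rewrite /G (_ : 'C((Rb - i).+1, 2) = \sum_(1 <= k < (Rb - i).+1) k)%N; last first.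
  rewrite -[in LHS](@bin2_sum (Rb - i).+1) big_ltn//.
rewrite -prodrXr -big_split /=.
rewrite -{1}[i.+1]addn1 addnC big_addn subSn //.
rewrite big_nat_cond [RHS]big_nat; apply: eq_big => [k|k /andP[/andP[k1 kR] _]].
  rewrite andbC; case: eqVneq => //= e; move: e; rewrite -[RHS]add0n => /eqP.
  by rewrite eqn_add2r => /eqP ->.
have e : y ^+ i / y ^+ (k + i) = (y ^+ k)^-1.
  by rewrite exprD invfM mulrCA mulfV ?mulr1// gt_eqF.
rewrite powR2_node e ltr0_norm; last first.
  by rewrite subr_lt0 invf_gt1//; case: k k1 {kR e}.
have yk0 : y ^+ k != 0 by rewrite gt_eqF.
have yk1 : 1 - y ^+ k != 0 by rewrite subr_eq0 gt_eqF//; case: k k1 {kR e yk0}.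
by rewrite opprB; field; rewrite yk0 yk1.
Qed.

(** Each of the two factors [G] in [weight_wE] is at most exp((1 - y)^(-2)). *)
Definition weight_bound : R := expR ((1 - y)^-1 ^+ 2) ^+ 2.

Let G_gt0 n : 0 < G n.
Proof.
rewrite /G big_nat; apply: prodr_gt0 => k /andP[k1 _].
by rewrite invr_gt0 subr_gt0; case: k k1.
Qed.

Let G_le n : G n <= expR ((1 - y)^-1 ^+ 2).
Proof.
have h : 0 < 1 - y by rewrite subr_gt0.
(* Here 1 / (1 - y^k) = 1 + y^k / (1 - y^k) <= 1 + y^k / (1 - y), after which 1 + u <= exp(u) turns
   the product into a geometric sum. *)
apply: (@le_trans _ _ (\prod_(1 <= k < n.+1) (1 + y ^+ k / (1 - y)))).
  rewrite /G big_nat [leRHS]big_nat; apply: ler_prod => k /andP[k1 _].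
  have hk : 0 < 1 - y ^+ k by rewrite subr_gt0; case: k k1.
  rewrite invr_ge0 ltW//= -[leLHS]mul1r ler_pdivrMr//.
  have yk : y ^+ k <= y by rewrite -[leRHS]expr1 ler_wiXn2l// ltW.
  have : 1 <= (1 - y ^+ k) / (1 - y) by rewrite ler_pdivlMr// mul1r lerD2l lerN2.
  move: (yn_gt0 k); set u := y ^+ k; set v := (1 - y)^-1 => u0 uv.
  have := ler_wpM2l (ltW u0) uv; lra.
apply: (le_trans (expR_ge_prod _ _)) => [k|].
  by rewrite divr_ge0// ltW.
rewrite ler_expR -mulr_suml expr2 ler_wpM2r// ?invr_ge0 ?(ltW h)//.
by rewrite geometric_sum_le// y_ge0.
Qed.

Lemma weight_bound_ge0 : 0 <= weight_bound.
Proof. by rewrite exprn_ge0// expR_ge0. Qed.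

Lemma normr_weight_w_le Rb i : (1 <= i <= Rb)%N ->
  `|weight_w alpha Rb i| <= weight_bound * y ^+ 'C((Rb - i).+1, 2).
Proof.
move=> iR; rewrite weight_wE// !normrM normrX normrN1 expr1n mul1r.
rewrite !(gtr0_norm (G_gt0 _)) (gtr0_norm (yn_gt0 _)).
by rewrite ler_wpM2r ?(ltW (yn_gt0 _))// /weight_bound expr2 ler_pM// ltW.
Qed.

Lemma bin2_ge_pred n : (n.-1 <= 'C(n, 2))%N.
Proof.
case: n => // n /=; rewrite binS bin1; exact: leq_addl.
Qed.

(** For R = i + 1 + j, the exponent of y in the weight w_(i+1) plus that of the node power y^(i R)
    separates into C(R, 2), common to all levels, and C(i + 1, 2), which makes the sum over the
    levels converge. *)
Lemma bin2_split i j :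
  ('C((i.+1 + j - i.+1).+1, 2) + i * (i.+1 + j) = 'C(i.+1 + j, 2) + 'C(i.+1, 2))%N.
Proof.
have binS2 n : 'C(n.+1, 2) = ('C(n, 2) + n)%N by rewrite binS bin1.
rewrite addKn; elim: i => [|i IH]; first by rewrite mul0n addn0.
by rewrite [(i.+2 + j)%N]addSn (binS2 (i.+1 + j)%N) (binS2 i.+1); lia.
Qed.

(** The weights concentrate on the finest levels: by C(R - i + 1, 2) >= R - i, the weight w_i is
    O(y^(R-i)). *)
Lemma sum_weight_w_le Rb r : (r <= Rb.+1)%N ->
  \sum_(1 <= i < r) `|weight_w alpha Rb i| <=
  weight_bound / (1 - y) * y ^+ (Rb.+1 - r).
Proof.
move=> rR; apply: (@le_trans _ _
  (\sum_(1 <= i < r) weight_bound * y ^+ (Rb.+1 - r) * y ^+ (r.-1 - i))).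
  apply: ler_sum_nat => i /andP[i1 ir].
  apply: (le_trans (normr_weight_w_le _)).
    by rewrite i1 -ltnS (leq_trans ir).
  rewrite -(mulrA weight_bound) -exprD ler_wpM2l ?weight_bound_ge0// ler_wiXn2l// ?ltW//.
  by apply: leq_trans (bin2_ge_pred _); rewrite /=; lia.
rewrite -mulr_sumr [leRHS]mulrAC.
rewrite ler_wpM2l ?mulr_ge0 ?weight_bound_ge0// ?(ltW (yn_gt0 _))//.
rewrite big_nat_rev big_nat /= (eq_bigr (fun k => y ^+ k.-1)); last first.
  by move=> k /andP[k1 kr]; congr (_ ^+ _); lia.
rewrite -big_nat big_add1 /=.
by rewrite geometric_sum_le// y_ge0.
Qed.

Lemma sum_weight_w_node_le Rb :
  \sum_(1 <= i < Rb.+1) `|weight_w alpha Rb i| * y ^+ (i.-1 * Rb) <=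
  weight_bound / (1 - y) * y ^+ 'C(Rb, 2).
Proof.
apply: (@le_trans _ _
  (\sum_(1 <= i < Rb.+1) weight_bound * y ^+ 'C(Rb, 2) * y ^+ i.-1)).
  apply: ler_sum_nat => i /andP[i1 iR].
  apply: (le_trans (ler_wpM2r (ltW (yn_gt0 _)) (normr_weight_w_le _))).
    by rewrite i1.
  rewrite -2!(mulrA weight_bound) -!exprD ler_wpM2l ?weight_bound_ge0// ler_wiXn2l// ?ltW//.
  have [j ->] : exists j, Rb = (i + j)%N by exists (Rb - i)%N; lia.
  case: i i1 {iR} => // i _.
  by have := bin2_split i j; have := bin2_ge_pred i.+1; rewrite /=; lia.
rewrite -mulr_sumr [leRHS]mulrAC.
rewrite ler_wpM2l ?mulr_ge0 ?weight_bound_ge0// ?(ltW (yn_gt0 _))//.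
by rewrite big_add1 /= geometric_sum_le// y_ge0.
Qed.

(* The weights are the values at 0 of the Lagrange basis for the nodes
   [y ^+ (i - 1)]. *)
Lemma weight_w_lagrange Rb i : (1 <= i <= Rb)%N ->
  weight_w alpha Rb i =
  \prod_(1 <= j < Rb.+1 | j != i) (y ^+ j.-1 / (y ^+ j.-1 - y ^+ i.-1)).
Proof.
move=> /andP[i1 iR]; rewrite /weight_w.
(* The sign is distributed as one factor -1 for each j > i, exactly the indices at which the
   absolute value changes the sign of 1 - 2^(alpha (j - i)). *)
have -> : (-1) ^+ (Rb - i) =
    \prod_(1 <= j < Rb.+1 | j != i) (if (i < j)%N then -1 else 1) :> R.
  rewrite (@big_cat_nat _ _ _ i.+1)//= [X in X * _]big_nat_cond.
  rewrite [X in X * _]big1 ?mul1r; last first.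
    by move=> j /andP[/andP[_ ji] _]; rewrite ltnNge -ltnS ji.
  rewrite big_nat_cond (eq_big (fun j => (i < j < Rb.+1)%N) (fun=> -1)).
  - by rewrite -big_nat prodr_const_nat subSS.
  - by move=> j; case: eqVneq => [->|]; rewrite ?ltnn ?andbT.
  - by move=> j /andP[/andP[-> _] _].
rewrite -big_split /= big_nat_cond [RHS]big_nat_cond.
apply: eq_bigr => j /andP[/andP[j1 _] ji].
have -> : 2 `^ (alpha * (j%:R - i%:R)) = y ^+ i.-1 / y ^+ j.-1.
  rewrite powR2_node; case: i j i1 j1 {iR ji} => [//|i] [//|j] _ _ /=.
  by rewrite !exprS invfM mulrACA mulfV ?mul1r// gt_eqF.
have yj0 : y ^+ j.-1 != 0 by rewrite gt_eqF.
have H : y ^+ j.-1 / (y ^+ j.-1 - y ^+ i.-1) = (1 - y ^+ i.-1 / y ^+ j.-1)^-1.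
  by rewrite -[X in X - _ / _](mulfV yj0) -mulrBl invfM invrK mulrC.
rewrite H; have [ij|] := ltnP i j.
  rewrite ltr0_norm ?invrN ?mulrNN ?mul1r//.
  by rewrite subr_lt0 ltr_pdivlMr// mul1r ltr_iXn2l//; lia.
rewrite leq_eqVlt (negbTE ji) /= => {}ji.
rewrite gtr0_norm ?mul1r// subr_gt0 ltr_pdivrMr// mul1r ltr_iXn2l//; lia.
Qed.

(** Interpolation at [Rb] nodes is exact for X^r with r < Rb, and its value at 0 is 0^r. *)
Lemma sum_weight_w_moment Rb r : (r < Rb)%N ->
  \sum_(1 <= i < Rb.+1) weight_w alpha Rb i * y ^+ (i.-1 * r) = (r == 0%N)%:R.
Proof.
move=> rR.
pose s := [seq y ^+ i.-1 | i <- index_iota 1 Rb.+1].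
have xinj : {in index_iota 1 Rb.+1 &, injective (fun i => y ^+ i.-1)}.
  move=> [|i] [|j]; rewrite !mem_index_iota//= => _ _.
  by move=> /(ieexprIn y_gt0 y_neq1) ->.
have us : uniq s by rewrite map_inj_in_uniq// iota_uniq.
have ss : size s = Rb by rewrite size_map size_iota subn1.
have := @interpolation_at0 _ s 'X^r us; rewrite ss size_polyXn => /(_ rR).
rewrite hornerXn expr0n => <-; rewrite /s big_map.
apply: eq_big_nat => i /andP[i1 iR].
rewrite hornerXn -exprM mulrC weight_w_lagrange ?i1//; congr (_ * _).
rewrite big_map [LHS]big_nat_cond [RHS]big_nat_cond; apply: eq_bigl => j.
case jR : (1 <= j < Rb.+1)%N => //=.
rewrite (inj_in_eq xinj) ?mem_index_iota// i1//.
Qed.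

Lemma weight_W1 Rb : (0 < Rb)%N -> weight_W alpha Rb 1 = 1.
Proof.
move=> R0; rewrite /weight_W -[RHS](sum_weight_w_moment R0).
by apply: eq_bigr => i _; rewrite muln0 expr0 mulr1.
Qed.

Lemma normr_weight_W_le Rb r : (1 <= r <= Rb)%N ->
  `|weight_W alpha Rb r| <= weight_bound / (1 - y).
Proof.
move=> /andP[r1 rR]; apply: (le_trans (ler_norm_sum _ _ _)).
have := @sum_weight_w_le Rb Rb.+1 (leqnn _); rewrite subnn expr0 mulr1.
apply: le_trans; rewrite (@big_cat_nat _ _ _ r 1)//=; last exact: leqW.
by rewrite lerDr sumr_ge0.
Qed.

(** By [weight_W1], the difference 1 - W_r is the sum of the first r - 1 weights. *)
Lemma weight_W_sub1 Rb r : (1 <= r <= Rb)%N ->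
  `|1 - weight_W alpha Rb r| <= weight_bound / (1 - y) * y ^+ (Rb.+1 - r).
Proof.
move=> /andP[r1 rR]; rewrite -[X in `|X - _|](@weight_W1 Rb); last exact: leq_trans rR.
rewrite /weight_W (@big_cat_nat _ _ _ r 1)//=; last exact: leqW.
rewrite addrK (le_trans (ler_norm_sum _ _ _))// sum_weight_w_le//.
exact: leqW.
Qed.

(** For fixed r, W_r^R tends to 1 as R grows. A weight may vanish for some R, but not a given one
    for large R; this supports the divergence of the inner cost when beta <= 1. *)
Lemma weight_W_lim r : (1 <= r)%N ->
  exists N, forall Rb, (N <= Rb)%N -> 2^-1 <= `|weight_W alpha Rb r|.
Proof.
move=> r1; pose b := weight_bound / (1 - y).
have : y ^+ n @[n --> \oo] --> 0 by apply: cvg_expr; rewrite gtr0_norm.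
move=> /cvgrPdist_lt /(_ ((2 * (b + 1))^-1)) H.
have b0 : 0 <= b by rewrite divr_ge0 ?weight_bound_ge0// subr_ge0 ltW.
have {H}[|N _ H] := H; first by rewrite invr_gt0 mulr_gt0// ltr_wpDl.
exists (N + r)%N => Rb NR.
have rR : (1 <= r <= Rb)%N by lia.
have := H (Rb.+1 - r)%N => /(_ _)/=; rewrite sub0r normrN (gtr0_norm (yn_gt0 _)).
have NR' : (N <= Rb.+1 - r)%N by lia.
move=> /(_ NR') yb.
have : `|1 - weight_W alpha Rb r| <= 2^-1.
  apply: (le_trans (weight_W_sub1 rR)).
  apply: (@le_trans _ _ ((b + 1) * (2 * (b + 1))^-1)).
    apply: ler_pM => //; [exact: ltW|by rewrite lerDl|exact: ltW].
  by rewrite invfM mulrCA mulfV ?mulr1// gt_eqF// ltr_wpDl.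
rewrite ler_norml => /andP[_ h].
rewrite (le_trans _ (ler_norm _))//; move: h; lra.
Qed.

End Weights.

(** * Upper and lower limits at 0 from the right *)

Section Limsup.
Context (R : realType).
Implicit Types (g h : R -> R).

Lemma limsup0_le_near (g : R -> \bar R) (C : \bar R) :
  (\forall e \near 0^'+, (g e <= C)%E) -> (limsup0 g <= C)%E.
Proof.
move=> gC; apply: (@le_trans _ _ (ereal_sup (g @` [set e | (g e <= C)%E]))).
  by apply: ereal_inf_lbound; exists [set e | (g e <= C)%E].
by apply: ge_ereal_sup => _ [e /= ge <-].
Qed.

Lemma limsup0_lt_near (g : R -> \bar R) (C : \bar R) :
  (limsup0 g < C)%E -> \forall e \near 0^'+, (g e <= C)%E.
Proof.
move=> /ereal_inf_lt [_ [V FV <-] VC]; apply: filterS FV => e Ve.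
by rewrite ltW// (le_lt_trans _ VC)//; apply: ereal_sup_ubound; exists e.
Qed.

(** Replaces extended limsups by eventual real bounds. The sign of [g] is free, so its limsup may
    also be -oo. *)
Lemma limsup0_le_mul g h (k : R) : 0 < k ->
  (limsup0 (fun e => (g e)%:E) < +oo)%E ->
  (forall M d, 0 < d -> (\forall e \near 0^'+, g e <= M) ->
    \forall e \near 0^'+, h e <= k * M + d) ->
  (limsup0 (fun e => (h e)%:E) <= k%:E * limsup0 (fun e => (g e)%:E))%E.
Proof.
move=> k0 goo H.
have {}H M d : 0 < d -> (limsup0 (fun e => (g e)%:E) < M%:E)%E ->
    (limsup0 (fun e => (h e)%:E) <= (k * M + d)%:E)%E.
  move=> d0 /limsup0_lt_near gM; apply: limsup0_le_near.
  under eq_near do rewrite lee_fin.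
  by apply: H => //; under eq_near do rewrite -lee_fin.
move: goo H; case: (limsup0 _) => [r _ H| //|_ H].
  apply/lee_addgt0Pr => d d0.
  (* Half of the slack is spent in exceeding the limsup of [g], rescaled by [k], and half in the
     hypothesis. *)
  have := H (r + (d / 2) / k) (d / 2); rewrite lte_fin ltrDl !divr_gt0//.
  by rewrite mulrDr mulrCA divff ?gt_eqF// mulr1 -addrA -splitr EFinD EFinM; apply.
(* When the limsup of [g] is -oo, the bound M = (A - 1) / k is eventually valid for every real A, so
   the limsup of [h] is below every real. *)
have hA A : (limsup0 (fun e => (h e)%:E) <= A%:E)%E.
  have := H ((A - 1) / k) 1 ltr01 (ltNyr _).
  by rewrite mulrCA divff ?gt_eqF// mulr1 subrK.
rewrite gt0_muleNy ?lte_fin//.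
case: (limsup0 _) hA => [r /(_ (r - 1))|/(_ 0)|] //.
by rewrite lee_fin lerDl oppr_ge0 ler10.
Qed.

Lemma limsup0_le_mul_cvg g h (k : R) (rho : R -> R) : 0 < k ->
  (\forall e \near 0^'+, h e = rho e * g e) ->
  rho e @[e --> 0^'+] --> k ->
  (limsup0 (fun e => (g e)%:E) < +oo)%E ->
  (limsup0 (fun e => (h e)%:E) <= k%:E * limsup0 (fun e => (g e)%:E))%E.
Proof.
move=> k0 hE rhok goo; apply: limsup0_le_mul => // M d d0 gM.
have rhoM : rho e * M @[e --> 0^'+] --> k * M by apply: cvgMl.
move/cvgrPdist_lt: rhoM => /(_ _ d0) rhoM.
move/cvgrPdist_lt: rhok => /(_ _ k0) rho0.
near=> e; have -> : h e = rho e * g e by near: e.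
(* Since the limit [k] is positive, [rho] is eventually nonnegative; multiplying [g e <= M] by it
   then requires no sign of [g e] or [M]. *)
have rhoe : 0 <= rho e.
  have : `|k - rho e| < k by near: e.
  by rewrite ltr_norml => /andP[_]; lra.
have : `|k * M - rho e * M| < d by near: e.
rewrite ltr_norml => /andP[+ _].
have : rho e * g e <= rho e * M by rewrite ler_wpM2l//; near: e.
lra.
Unshelve. all: by end_near. Qed.

Lemma liminf0_lt_near (g : R -> R) (c : R) :
  (c%:E < limf_einf (fun e => (g e)%:E) 0^'+)%E -> \forall e \near 0^'+, c <= g e.
Proof.
rewrite limf_einfE => /ereal_sup_gt [_ [V FV <-] cV]; apply: filterS FV => e Ve.
rewrite -lee_fin ltW// (lt_le_trans cV)//.
by apply: ereal_inf_lbound; exists e.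
Qed.

Lemma liminf0_itv (g : R -> R) (a b : R) :
  (\forall e \near 0^'+, a <= g e <= b) ->
  exists2 c, a <= c & limf_einf (fun e => (g e)%:E) 0^'+ = c%:E.
Proof.
move=> gab.
have la : (a%:E <= limf_einf (fun e => (g e)%:E) 0^'+)%E.
  rewrite limf_einfE; apply: (@le_trans _ _
    (ereal_inf ((fun e => (g e)%:E) @` [set e | a <= g e <= b]))).
    by apply: le_ereal_inf_tmp => _ [e /= /andP[ae _] <-]; rewrite lee_fin.
  by apply: ereal_sup_ubound; exists [set e | a <= g e <= b].
have lb : (limf_einf (fun e => (g e)%:E) 0^'+ <= b%:E)%E.
  rewrite limf_einfE; apply: ge_ereal_sup => _ [V FV <-].
  have [e [Ve /= /andP[_ eb]]] := @filter_ex _ _ (at_right_proper_filter (0 : R)) _ (filterI FV gab).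
  by apply: (@le_trans _ _ (g e)%:E); [apply: ereal_inf_lbound; exists e|rewrite lee_fin].
move: la lb; case: (limf_einf _ _) => // c; rewrite lee_fin => ac _.
by exists c.
Qed.

End Limsup.

(** * The natural-number ceiling *)

Section Ceiling.
Context (R : realType).
Implicit Types x : R.

Lemma ceilnE x : 0 < x -> (ceiln x)%:R = (Num.ceil x)%:~R :> R.
Proof.
by move=> x0; rewrite /ceiln natr_absz ger0_norm// ceil_ge0 (lt_trans _ x0)// oppr_lt0.
Qed.

Lemma ceiln_ge x : 0 < x -> x <= (ceiln x)%:R.
Proof. by move=> x0; rewrite ceilnE// ceil_ge. Qed.

Lemma ceiln_lt x : 0 < x -> (ceiln x)%:R < x + 1.
Proof.
by move=> x0; rewrite ceilnE// -ltrBlDr; have := ceilB1_lt x; rewrite intrD.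
Qed.

Lemma ceiln_gt0 x : 0 < x -> (0 < ceiln x)%N.
Proof. by move=> x0; rewrite -(ltr_nat R) (lt_le_trans x0)// ceiln_ge. Qed.

Lemma ceiln_le x n : 0 < x -> x <= n%:R -> (ceiln x <= n)%N.
Proof.
move=> x0 xn; rewrite -(ler_nat R) ceilnE// [leRHS]pmulrn ler_int.
by rewrite ceil_le_int.
Qed.

Lemma ceiln_nat n : ceiln (n%:R : R) = n.
Proof. by rewrite /ceiln [n%:R]pmulrn intrKceil. Qed.

End Ceiling.

(** * Binary logarithms *)

Section Log.
Context (R : realType).
Implicit Types x y : R.

Lemma ln2_gt0 : 0 < ln 2 :> R. Proof. by rewrite ln_gt0// ltr1n. Qed.

Lemma log2M x y : 0 < x -> 0 < y -> log2 (x * y) = log2 x + log2 y.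
Proof. by move=> x0 y0; rewrite /log2 lnM ?posrE// mulrDl. Qed.

Lemma log2_powR x y : log2 (x `^ y) = y * log2 x.
Proof. by rewrite /log2 ln_powR mulrA. Qed.

Lemma powR2_log2 x : 0 < x -> 2 `^ (log2 x) = x.
Proof. by move=> x0; rewrite powR_expR// /log2 divfK ?gt_eqF ?ln2_gt0// lnK. Qed.

Lemma log2_sqrt x : 0 <= x -> log2 (Num.sqrt x) = 2^-1 * log2 x.
Proof. by move=> x0; rewrite -powR12_sqrt// log2_powR. Qed.

Lemma ln_inv_near A : \forall e \near (0 : R)^'+, 0 < e /\ A <= ln e^-1.
Proof.
near=> e; have e0 : 0 < e by [].
split=> //; rewrite lnV ?posrE// lerNr.
have : e <= expR (- A) by near: e; apply: nbhs_right_le; exact: expR_gt0.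
by rewrite -ler_ln ?posrE ?expR_gt0// expRK.
Unshelve. all: by end_near. Qed.

(** From exp(t) >= 1 + t^2 / 2 at t = x ln 2; the threshold is where t^2 / 2 reaches x. *)
Lemma log2_1D_le x : 2 / ln 2 ^+ 2 <= x -> log2 (1 + x) <= x.
Proof.
have l2 := ln2_gt0; move=> xl.
have x0 : 0 < x by rewrite (lt_le_trans _ xl)// divr_gt0// exprn_gt0.
rewrite /log2 ler_pdivrMr// -ler_expR lnK ?posrE ?addr_gt0//.
have := @expR_ge1Dxn _ (x * ln 2) 1 (mulr_ge0 (ltW x0) (ltW l2)).
apply: le_trans; rewrite lerD2l ler_pdivlMr// exprMn expr2 -mulrA.
by rewrite ler_wpM2l ?(ltW x0)// -ler_pdivrMr// exprn_gt0.
Qed.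

End Log.

(** * Asymptotics of R(eps) and K(eps), and the resulting rates *)

Section ClosedForm.
Context (R : realType) (alpha ct : R) (Ku : nat).
Hypotheses (alpha_gt0 : 0 < alpha) (ct_gt0 : 0 < ct) (Ku_gt0 : (0 < Ku)%N).

Let Ku0 : 0 < Ku%:R :> R. Proof. by rewrite ltr0n. Qed.

Let b := 2^-1 + log2 (ct `^ alpha^-1 / Ku%:R).

Definition level_bound (k : ml_kind) (e : R) : R :=
  match k with
  | MLMC => 1 + log2 (ct `^ alpha^-1 / Ku%:R)
            + alpha^-1 * log2 (Num.sqrt (1 + 2 * alpha) * e^-1)
  | ML2R => b + Num.sqrt (b ^+ 2
               + 2 / alpha * log2 (e^-1 * Num.sqrt (1 + 4 * alpha)))
  end.

Lemma opt_R_level_bound k e : opt_R k alpha ct Ku e = ceiln (level_bound k e).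
Proof. by case: k. Qed.

Lemma level_bound_MLMC : exists c, forall e, 0 < e ->
  level_bound MLMC e = c + (alpha * ln 2)^-1 * ln e^-1.
Proof.
exists (1 + log2 (ct `^ alpha^-1 / Ku%:R)
         + alpha^-1 * log2 (Num.sqrt (1 + 2 * alpha))) => e e0.
have s2 : 0 < Num.sqrt (1 + 2 * alpha) by rewrite sqrtr_gt0 addr_gt0// mulr_gt0.
rewrite /level_bound (log2M s2) ?invr_gt0//.
by rewrite mulrDr addrA invfM {3}/log2; congr (_ + _); rewrite -!mulrA [_ / _]mulrC.
Qed.

(** Subadditivity of the square root detaches the part that grows with ln(1 / eps). *)
Lemma level_bound_ML2R : exists c, forall e, 0 < e -> 0 <= ln e^-1 ->
  level_bound ML2R e <= c + Num.sqrt (2 / (alpha * ln 2) * ln e^-1).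
Proof.
have l2 := ln2_gt0 R.
have s4 : 0 < Num.sqrt (1 + 4 * alpha) by rewrite sqrtr_gt0 addr_gt0// mulr_gt0.
pose B := b ^+ 2 + 2 / alpha * log2 (Num.sqrt (1 + 4 * alpha)).
have B0 : 0 <= B.
  rewrite addr_ge0 ?sqr_ge0// mulr_ge0 ?divr_ge0 ?(ltW alpha_gt0) ?(ltW l2)//.
  by rewrite ln_ge0// -[leLHS]sqrtr1 ler_wsqrtr// lerDl mulr_ge0// ltW.
exists (b + Num.sqrt B) => e e0 L0.
rewrite /level_bound (log2M _ s4) ?invr_gt0// -[leRHS]addrA lerD2l.
have -> : b ^+ 2 + 2 / alpha * (log2 e^-1 + log2 (Num.sqrt (1 + 4 * alpha))) =
    B + 2 / (alpha * ln 2) * ln e^-1.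
  rewrite /B /log2; field; rewrite !gt_eqF//.
set C := 2 / _ * _; have C0 : 0 <= C.
  by rewrite mulr_ge0// divr_ge0// mulr_ge0// ltW.
have BC : 0 <= B + C by exact: addr_ge0.
have sBC : 0 <= Num.sqrt B + Num.sqrt C by rewrite addr_ge0 ?sqrtr_ge0.
rewrite -ler_sqr ?nnegrE ?sqrtr_ge0// sqrrD !sqr_sqrtr//.
by rewrite [leRHS]addrAC lerDl mulrn_wge0// mulr_ge0// sqrtr_ge0.
Qed.

Lemma level_bound_near k A : \forall e \near (0 : R)^'+, A <= level_bound k e.
Proof.
have l2 := ln2_gt0 R; have la : 0 < alpha * ln 2 by rewrite mulr_gt0.
case: k.
  have [c cE] := level_bound_MLMC.
  near=> e; have [e0 eA] : 0 < e /\ (A - c) * (alpha * ln 2) <= ln e^-1.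
    by near: e; exact: ln_inv_near.
  rewrite cE// -lerBlDl (le_trans _ (ler_wpM2l _ eA)) ?invr_ge0 ?(ltW la)//.
  by rewrite mulrCA mulVf ?mulr1// gt_eqF.
have s4 : 0 < Num.sqrt (1 + 4 * alpha) by rewrite sqrtr_gt0 addr_gt0// mulr_gt0.
pose D := (A - b) ^+ 2 * (alpha * ln 2).
near=> e; have [e0 eA] : 0 < e /\ D <= ln e^-1 by near: e; exact: ln_inv_near.
rewrite -lerBlDl (le_trans (ler_norm _))// -sqrtr_sqr ler_wsqrtr//.
rewrite (log2M _ s4) ?invr_gt0// mulrDr.
have := ler_wpM2l (_ : 0 <= (alpha * ln 2)^-1) eA.
rewrite invr_ge0 (ltW la) => /(_ isT); rewrite /D mulrCA mulVf ?gt_eqF// mulr1 => h.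
have h2 : 0 <= 2 / alpha * log2 (Num.sqrt (1 + 4 * alpha)).
  rewrite mulr_ge0 ?divr_ge0 ?(ltW alpha_gt0) ?(ltW l2)//.
  by rewrite ln_ge0// -[leLHS]sqrtr1 ler_wsqrtr// lerDl mulr_ge0// ltW.
have h3 : 2 / alpha * log2 e^-1 = 2 * ((alpha * ln 2)^-1 * ln e^-1).
  by rewrite /log2; field; rewrite !gt_eqF.
have := sqr_ge0 b; have := sqr_ge0 (A - b); rewrite h3; lra.
Unshelve. all: by end_near. Qed.

Lemma opt_R_near k n : \forall e \near (0 : R)^'+, (n <= opt_R k alpha ct Ku e)%N.
Proof.
have := level_bound_near k n.+1%:R; apply: filterS => e le.
rewrite opt_R_level_bound -(ler_nat R).
have l0 : 0 < level_bound k e by rewrite (lt_le_trans _ le)// ltr0Sn.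
by rewrite (le_trans _ (ceiln_ge l0))// (le_trans _ le)// ler_nat.
Qed.

Lemma opt_Kplus_gt0 k n e : 0 < e -> 0 < opt_Kplus k alpha ct n e.
Proof.
move=> e0; case: k; rewrite /opt_Kplus !mulr_gt0 ?powR_gt0//.
  by rewrite ltr_pwDl// mulr_ge0// ltW.
by rewrite ltr_pwDl// !mulr_ge0// ltW.
Qed.

(** K(eps) is already an integer, so the ceiling in [lev_K] leaves it unchanged. *)
Definition opt_Kn k (e : R) : nat :=
  (Ku * ceiln (opt_Kplus k alpha ct (opt_R k alpha ct Ku e) e / Ku%:R))%N.

Lemma opt_KE k e : opt_K k alpha ct Ku e = (opt_Kn k e)%:R.
Proof. by rewrite natrM. Qed.

Lemma opt_Kn_ge k e : 0 < e -> (Ku <= opt_Kn k e)%N.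
Proof.
by move=> e0; rewrite leq_pmulr// ceiln_gt0// divr_gt0// opt_Kplus_gt0.
Qed.

Lemma opt_Kplus_le k e : 0 < e ->
  opt_Kplus k alpha ct (opt_R k alpha ct Ku e) e <= (opt_Kn k e)%:R.
Proof.
move=> e0; rewrite natrM mulrC -ler_pdivrMr// ceiln_ge//.
by rewrite divr_gt0// opt_Kplus_gt0.
Qed.

Lemma opt_Kn_le k e m : 0 < e ->
  log2 (opt_Kplus k alpha ct (opt_R k alpha ct Ku e) e / Ku%:R) <= m%:R ->
  (opt_Kn k e <= Ku * 2 ^ m)%N.
Proof.
move=> e0; set K := opt_Kplus _ _ _ _ _ => Km.
have KK : 0 < K / Ku%:R by rewrite divr_gt0// opt_Kplus_gt0.
rewrite /opt_Kn leq_mul2l ceiln_le ?orbT// natrX -powR_mulrn//.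
by rewrite -[leLHS]powR2_log2// ler_powR// ler1n.
Qed.

Lemma log2V x : 0 < x -> log2 x^-1 = - log2 x :> R.
Proof. by move=> x0; rewrite /log2 lnV ?posrE// mulNr. Qed.

(** For n = R(eps), the ceiling of [level_bound], the right side is nonpositive; hence K^+ <= Ku,
    and K = Ku after rounding. *)
Lemma log2_opt_Kplus_MLMC n e : 0 < e ->
  log2 (opt_Kplus MLMC alpha ct n e / Ku%:R) = level_bound MLMC e - n%:R.
Proof.
move=> e0; rewrite /opt_Kplus /level_bound.
have a2 : 0 < 1 + 2 * alpha by rewrite ltr_pwDl// mulr_ge0// ltW.
have s2 : 0 < Num.sqrt (1 + 2 * alpha) by rewrite sqrtr_gt0.
rewrite !log2M ?mulr_gt0 ?invr_gt0 ?powR_gt0// !log2_powR log2_sqrt ?(ltW a2)//.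
rewrite !log2V// /log2 divff ?gt_eqF ?ln2_gt0//.
by field; rewrite !gt_eqF ?ln2_gt0.
Qed.

Lemma log2_opt_Kplus_ML2R n e : 0 < e -> (0 < n)%N ->
  log2 (opt_Kplus ML2R alpha ct n e / Ku%:R) =
  (2 * alpha * n%:R)^-1 * log2 (1 + 2 * alpha * n%:R)
  + (alpha * n%:R)^-1 * log2 e^-1 + b - n%:R / 2.
Proof.
move=> e0 n0; rewrite /opt_Kplus /b.
have n0' : 0 < n%:R :> R by rewrite ltr0n.
have a2 : 0 < 1 + 2 * alpha * n%:R by rewrite ltr_pwDl// !mulr_ge0// ltW.
rewrite !log2M ?mulr_gt0 ?invr_gt0 ?powR_gt0// !log2_powR.
rewrite !log2V// /log2 divff ?gt_eqF ?ln2_gt0//.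
by field; rewrite !gt_eqF ?ln2_gt0.
Qed.

Lemma opt_Kn_MLMC : \forall e \near (0 : R)^'+, opt_Kn MLMC e = Ku.
Proof.
near=> e; have e0 : 0 < e by [].
(* [ceiln] contains an absolute value, so positivity is secured before it is used as a ceiling. *)
have x1 : 1 <= level_bound MLMC e by near: e; exact: level_bound_near.
have x0 : 0 < level_bound MLMC e by rewrite (lt_le_trans _ x1).
apply/eqP; rewrite eqn_leq opt_Kn_ge// andbT.
have := @opt_Kn_le MLMC e 0 e0; rewrite expn0 muln1; apply.
by rewrite log2_opt_Kplus_MLMC// subr_le0 opt_R_level_bound ceiln_ge.
Unshelve. all: by end_near. Qed.

(** R(eps) is at least the larger root x of x^2 - 2 b x = (2 / alpha) log2(sqrt(1 + 4 alpha) / eps).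
    Completing the square bounds log2(1 / eps) / (alpha R) by R / 2 - b, which cancels the other
    terms of log2(K^+ / Ku) except one that is at most 1 for large R; hence K <= 2 Ku. *)
Lemma opt_Kn_ML2R : \forall e \near (0 : R)^'+, (opt_Kn ML2R e <= Ku * 2)%N.
Proof.
(* Beyond [m], the quantity 2 alpha n exceeds the threshold of [log2_1D_le]. *)
pose m := ceiln (2 / ln 2 ^+ 2 / (2 * alpha) : R).
have m0 : 0 < 2 / ln 2 ^+ 2 / (2 * alpha) :> R.
  by rewrite !divr_gt0 ?exprn_gt0 ?ln2_gt0// mulr_gt0.
near=> e; have [e0 L0] : 0 < e /\ 0 <= ln e^-1 by near: e; exact: ln_inv_near.
have x1 : 1 <= level_bound ML2R e by near: e; exact: level_bound_near.
have x0 : 0 < level_bound ML2R e by rewrite (lt_le_trans _ x1).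
have /(_ 1%N e0) := @opt_Kn_le ML2R e; rewrite expn1; apply.
have mn : (m.+1 <= opt_R ML2R alpha ct Ku e)%N by near: e; exact: opt_R_near.
have : level_bound ML2R e <= (opt_R ML2R alpha ct Ku e)%:R.
  by rewrite opt_R_level_bound ceiln_ge.
move: (opt_R _ _ _ _ _) mn => n mn xn.
have n0 : (0 < n)%N by exact: leq_trans mn.
have n0' : 0 < n%:R :> R by rewrite ltr0n.
rewrite log2_opt_Kplus_ML2R//.
have l1 : (2 * alpha * n%:R)^-1 * log2 (1 + 2 * alpha * n%:R) <= 1.
  rewrite mulrC ler_pdivrMr ?mulr_gt0// mul1r log2_1D_le//.
  rewrite -ler_pdivrMl ?mulr_gt0// [leLHS]mulrC (le_trans (ceiln_ge m0))// ler_nat.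
  exact: ltnW.
suff l2 : (alpha * n%:R)^-1 * log2 e^-1 <= n%:R / 2 - b by move: l1 l2; lra.
have l0 : 0 <= log2 e^-1 by rewrite divr_ge0// ltW// ln2_gt0.
have s4 : 0 < Num.sqrt (1 + 4 * alpha) by rewrite sqrtr_gt0 addr_gt0// mulr_gt0.
have ls4 : 0 <= log2 (Num.sqrt (1 + 4 * alpha)).
  rewrite divr_ge0 ?(ltW (ln2_gt0 R))// ln_ge0// -[leLHS]sqrtr1 ler_wsqrtr//.
  by rewrite lerDl mulr_ge0// ltW.
move: xn; rewrite /level_bound (log2M _ s4) ?invr_gt0// -lerBrDl => xn.
have a2 : 0 <= 2 / alpha by rewrite divr_ge0// ltW.
have h : b ^+ 2 + 2 / alpha * (log2 e^-1 + log2 (Num.sqrt (1 + 4 * alpha)))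
    <= (n%:R - b) ^+ 2.
  have h0 : 0 <= b ^+ 2 + 2 / alpha * (log2 e^-1 + log2 (Num.sqrt (1 + 4 * alpha))).
    by rewrite addr_ge0 ?sqr_ge0// mulr_ge0// addr_ge0.
  rewrite -[leLHS]sqr_sqrtr//.
  by rewrite ler_sqr ?nnegrE ?sqrtr_ge0// (le_trans (sqrtr_ge0 _) xn).
rewrite [leLHS]mulrC ler_pdivrMr ?mulr_gt0//.
have := ler_wpM2l (ltW alpha_gt0) h.
have q : alpha * (2 / alpha) = 2 by rewrite mulrC divfK ?gt_eqF.
rewrite mulrDr [X in _ + X <= _]mulrA q; move: ls4; lra.
Unshelve. all: by end_near. Qed.

Lemma natr_pred_ge m : m%:R - 1 <= m.-1%:R :> R.
Proof. by case: m => [|m] /=; [rewrite sub0r oppr_le0|rewrite -natr1 addrK]. Qed.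

Lemma bin2_natr m : 'C(m, 2)%:R = m%:R * (m%:R - 1) / 2 :> R.
Proof.
elim: m => [|m IH]; first by rewrite !mul0r.
by rewrite binS bin1 natrD IH -natr1; field.
Qed.

(** With K^+ in place of K this is an equality for R >= 1, by the choice of K^+; rounding K up only
    decreases the left side. *)
Lemma opt_Kn_powR_MLMC e : 0 < e ->
  (opt_Kn MLMC e * 2 ^ (opt_R MLMC alpha ct Ku e).-1)%:R `^ (- alpha)
  <= (1 + 2 * alpha) `^ (- 2^-1) * e / ct.
Proof.
move=> e0; set n := opt_R _ _ _ _ _.
have a2 : 0 < 1 + 2 * alpha by rewrite ltr_pwDl// mulr_ge0// ltW.
have K0 := opt_Kplus_gt0 MLMC n e0.
have KK : opt_Kplus MLMC alpha ct n e * 2 `^ (n.-1)%:R <=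
    (opt_Kn MLMC e * 2 ^ n.-1)%:R.
  by rewrite natrM natrX powR_mulrn// ler_wpM2r ?exprn_ge0// opt_Kplus_le.
have P0 : 0 < opt_Kplus MLMC alpha ct n e * 2 `^ (n.-1)%:R.
  by rewrite mulr_gt0// powR_gt0.
rewrite powRN; apply: (@le_trans _ _
  ((opt_Kplus MLMC alpha ct n e * 2 `^ (n.-1)%:R) `^ alpha)^-1).
  rewrite lef_pV2 ?posrE ?powR_gt0 ?(lt_le_trans P0)//.
  by rewrite ge0_ler_powR ?nnegrE ?(ltW alpha_gt0) ?(ltW P0) ?(le_trans (ltW P0)).
rewrite /opt_Kplus -mulrA -powRD_gt0// !powRM ?mulr_ge0 ?powR_ge0//.
rewrite -!powRrM.
have -> : (2 * alpha)^-1 * alpha = 2^-1 by field; rewrite gt_eqF.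
have -> : - alpha^-1 * alpha = - 1 by field; rewrite gt_eqF.
have -> : alpha^-1 * alpha = 1 by field; rewrite gt_eqF.
rewrite powR_inv1 ?(ltW e0)// powRr1 ?(ltW ct_gt0)// [in leRHS]powRN !invfM invrK.
rewrite ler_piMr ?mulr_ge0 ?invr_ge0 ?powR_ge0 ?(ltW e0) ?(ltW ct_gt0)//.
rewrite invf_le1 ?powR_gt0//.
rewrite -[leLHS](powRr0 2) ler_powR ?ler1n// mulr_ge0 ?(ltW alpha_gt0)//.
by rewrite addrC subr_ge0 natr_pred_ge.
Qed.

(** The factor 2^(-(R-1)/2) of K^+, raised to the power - alpha R, is 2^(alpha R (R-1) / 2) and
    cancels the power y^C(R, 2) produced by the weighted node sum. *)
Lemma opt_Kn_powR_ML2R e (n := opt_R ML2R alpha ct Ku e) : 0 < e -> (0 < n)%N ->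
  (opt_Kn ML2R e)%:R `^ (- (alpha * n%:R)) * (2 `^ (- alpha)) ^+ 'C(n, 2)
  <= (1 + 2 * alpha * n%:R) `^ (- 2^-1) * e * (ct ^+ n)^-1.
Proof.
move=> e0 n0.
have n0' : 0 < n%:R :> R by rewrite ltr0n.
have an0 : 0 < alpha * n%:R by rewrite mulr_gt0.
have a2 : 0 < 1 + 2 * alpha * n%:R by rewrite ltr_pwDl// !mulr_ge0// ltW.
have K0 := opt_Kplus_gt0 ML2R n e0.
have KK := opt_Kplus_le ML2R e0; rewrite -/n in KK.
apply: (@le_trans _ _ ((opt_Kplus ML2R alpha ct n e `^ (alpha * n%:R))^-1
    * 2 `^ (- alpha) ^+ 'C(n, 2))).
  rewrite ler_wpM2r ?exprn_ge0 ?powR_ge0// powRN.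
  rewrite lef_pV2 ?posrE ?powR_gt0 ?(lt_le_trans K0)//.
  by rewrite ge0_ler_powR ?nnegrE ?(ltW an0) ?(ltW K0) ?(le_trans (ltW K0)).
rewrite /opt_Kplus !powRM ?mulr_ge0 ?powR_ge0// -!powRrM.
have -> : (2 * alpha * n%:R)^-1 * (alpha * n%:R) = 2^-1.
  by field; rewrite !gt_eqF.
have -> : - (alpha * n%:R)^-1 * (alpha * n%:R) = - 1 by field; rewrite !gt_eqF.
have -> : alpha^-1 * (alpha * n%:R) = n%:R by field; rewrite gt_eqF.
rewrite powR_inv1 ?(ltW e0)// powR_mulrn ?(ltW ct_gt0)//.
rewrite [in leRHS]powRN !invfM invrK -[leLHS]mulrA.
set E := _ * _ ^+ _; suff -> : E = 1 by rewrite mulr1.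
rewrite /E -powR_mulrn ?powR_ge0// -powRrM -powRN -powRD_gt0//.
rewrite bin2_natr -[RHS](powRr0 2); congr (_ `^ _).
by field.
Qed.

Definition level_geom (beta : R) n : R := \sum_(0 <= k < n) (2 `^ ((1 - beta) / 2)) ^+ k.

Lemma level_geom_lt1 beta : beta < 1 ->
  exists2 C, 0 <= C & forall n, level_geom beta n ^+ 2 <= C * 2 `^ ((1 - beta) * n%:R).
Proof.
move=> b1; pose h : R := 2 `^ ((1 - beta) / 2).
have h1 : 1 < h.
  by rewrite /h powR_expR// expR_gt1 mulr_gt0 ?ln2_gt0// divr_gt0// subr_gt0.
exists (((h - 1)^-1) ^+ 2); first exact: sqr_ge0.
move=> m; have -> : 2 `^ ((1 - beta) * m%:R) = (h ^+ m) ^+ 2.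
  rewrite -exprM -powR_mulrn ?powR_ge0// -powRrM natrM.
  by congr (_ `^ _); field.
rewrite -exprMn ler_sqr ?nnegrE.
- rewrite mulrC ler_pdivlMr ?subr_gt0// mulrC /level_geom big_mkord -subrX1.
  by rewrite lerBlDr lerDl.
- by rewrite sumr_ge0// => k _; rewrite exprn_ge0// powR_ge0.
- by rewrite mulr_ge0 ?invr_ge0 ?subr_ge0 ?exprn_ge0 ?(ltW h1)// ltW// (lt_trans _ h1).
Qed.

Lemma opt_R_le k : \forall e \near (0 : R)^'+,
  (opt_R k alpha ct Ku e)%:R <= level_bound k e + 1.
Proof.
have := level_bound_near k 1; apply: filterS => e x1.
by rewrite opt_R_level_bound ltW// ceiln_lt// (lt_le_trans _ x1).
Qed.

(** For beta > 1 the geometric sum is bounded. For beta = 1 it equals R, which is O(ln(1/eps)) for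
    MLMC and O(sqrt(ln(1/eps))) for ML2R. For beta < 1 its square is O(2^((1-beta) R)), and the rate
    compensates the growing part of this exponential. *)
Lemma rate_level_geom k beta : exists2 C, 0 <= C &
  \forall e \near (0 : R)^'+,
    rate k alpha beta e * level_geom beta (opt_R k alpha ct Ku e) ^+ 2 <= C * e ^+ 2.
Proof.
have l2 := ln2_gt0 R.
have al2 : 0 < alpha * ln 2 by rewrite mulr_gt0.
have [b1|b1|b1] := ltgtP 1 beta; last first.
- subst beta; have geomE n : level_geom 1 n = n%:R.
    rewrite /level_geom subrr mul0r powRr0 big_mkord.
    by under eq_bigr do rewrite expr1n; rewrite sumr_const card_ord.
  case: k.
    have [c cE] := level_bound_MLMC; set q := (alpha * ln 2)^-1 in cE.
    have q0 : 0 <= q by rewrite invr_ge0 ltW.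
    exists ((`|c + 1| + q) ^+ 2); first exact: sqr_ge0.
    near=> e; have [e0 L1] : 0 < e /\ 1 <= ln e^-1 by near: e; exact: ln_inv_near.
    have nx : (opt_R MLMC alpha ct Ku e)%:R <= level_bound MLMC e + 1.
      by near: e; exact: opt_R_le.
    rewrite /rate ltxx eqxx geomE mulrC mulrCA [leRHS]mulrC ler_wpM2l ?sqr_ge0//.
    rewrite ler_pdivrMr ?exprn_gt0 ?(lt_le_trans _ L1)// -exprMn.
    rewrite ler_sqr ?nnegrE// ?mulr_ge0 ?addr_ge0 ?(le_trans _ L1)//.
    rewrite (le_trans nx)// cE// mulrDl addrAC lerD2r (le_trans (ler_norm _))//.
    by rewrite ler_peMr.
  have [c cE] := level_bound_ML2R; set q := 2 / (alpha * ln 2) in cE.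
  have q0 : 0 <= q by rewrite divr_ge0 ?ltW.
  exists (2 * (c + 1) ^+ 2 + 2 * q); first by apply: addr_ge0; apply: mulr_ge0 => //; exact: sqr_ge0.
  near=> e; have [e0 L1] : 0 < e /\ 1 <= ln e^-1 by near: e; exact: ln_inv_near.
  have L0 : 0 <= ln e^-1 by rewrite (le_trans _ L1).
  have nx : (opt_R ML2R alpha ct Ku e)%:R <= level_bound ML2R e + 1.
    by near: e; exact: opt_R_le.
  rewrite /rate ltxx eqxx geomE mulrC mulrCA [leRHS]mulrC ler_wpM2l ?sqr_ge0//.
  rewrite ler_pdivrMr ?(lt_le_trans _ L1)//.
  have qL : 0 <= q * ln e^-1 by rewrite mulr_ge0.
  have {}nx : (opt_R ML2R alpha ct Ku e)%:R <= (c + 1) + Num.sqrt (q * ln e^-1).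
    by rewrite (le_trans nx)// [leRHS]addrAC lerD2r cE.
  apply: (@le_trans _ _ (((c + 1) + Num.sqrt (q * ln e^-1)) ^+ 2)).
    by rewrite ler_sqr ?nnegrE// (le_trans _ nx).
  (* The inequality (u + v)^2 <= 2 u^2 + 2 v^2. *)
  apply: (@le_trans _ _ (2 * (c + 1) ^+ 2 + 2 * (q * ln e^-1))).
    rewrite -[in leRHS](sqr_sqrtr qL); have := sqr_ge0 (c + 1 - Num.sqrt (q * ln e^-1)).
    by nra.
  rewrite [leRHS]mulrDl; apply: lerD; last by rewrite mulrA.
  by rewrite ler_peMr// mulr_ge0// sqr_ge0.
- have [C0 C00 hC] := level_geom_lt1 b1.
  have bn : (1 < beta) = false by rewrite ltNge ltW.
  have bn' : (beta == 1) = false by rewrite lt_eqF.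
  have b0 : 0 < 1 - beta by rewrite subr_gt0.
  (* With the rate written as e^2 exp(-t), it remains to bound (1 - beta) R ln 2 by t plus a
     constant. *)
  have main c t e : rate k alpha beta e = e ^+ 2 * expR (- t) ->
      (1 - beta) * (opt_R k alpha ct Ku e)%:R * ln 2 <= c + t ->
      rate k alpha beta e * level_geom beta (opt_R k alpha ct Ku e) ^+ 2
        <= C0 * expR c * e ^+ 2.
    move=> -> h; rewrite [leRHS]mulrC -[leLHS]mulrA ler_wpM2l ?sqr_ge0//.
    apply: (le_trans (ler_wpM2l (expR_ge0 _) (hC _))).
    rewrite mulrCA ler_wpM2l// powR_expR// -expRD ler_expR addrC lerBlDr.
    exact: h.
  case: k main => main.
    have [c cE] := level_bound_MLMC.
    exists (C0 * expR ((1 - beta) * (c + 1) * ln 2)); first by rewrite mulr_ge0 ?expR_ge0.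
    near=> e; have [e0 L1] : 0 < e /\ 1 <= ln e^-1 by near: e; exact: ln_inv_near.
    have nx : (opt_R MLMC alpha ct Ku e)%:R <= level_bound MLMC e + 1.
      by near: e; exact: opt_R_le.
    apply: (main _ ((1 - beta) / alpha * ln e^-1)).
      rewrite /rate bn bn' powRD_gt0// powR_mulrn ?(ltW e0)//; congr (_ * _).
      by rewrite powR_expR// lnV ?posrE// mulrN opprK.
    rewrite (le_trans (ler_wpM2r (ltW l2) (ler_wpM2l (ltW b0) nx)))// cE//.
    by rewrite le_eqVlt; apply/orP; left; apply/eqP; field; rewrite !gt_eqF.
  have [c cE] := level_bound_ML2R.
  exists (C0 * expR ((1 - beta) * (c + 1) * ln 2)); first by rewrite mulr_ge0 ?expR_ge0.
  near=> e; have [e0 L1] : 0 < e /\ 1 <= ln e^-1 by near: e; exact: ln_inv_near.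
  have L0 : 0 <= ln e^-1 by rewrite (le_trans _ L1).
  have nx : (opt_R ML2R alpha ct Ku e)%:R <= level_bound ML2R e + 1.
    by near: e; exact: opt_R_le.
  apply: (main _ ((1 - beta) / Num.sqrt alpha * Num.sqrt (2 * ln (e^-1) * ln 2))).
    by rewrite /rate bn bn'.
  have {}nx := le_trans nx (lerD (cE e e0 L0) (lexx _)).
  rewrite (le_trans (ler_wpM2r (ltW l2) (ler_wpM2l (ltW b0) nx)))//.
  have -> : Num.sqrt (2 * ln e^-1 * ln 2) =
      Num.sqrt (2 / (alpha * ln 2) * ln e^-1) * (Num.sqrt alpha * ln 2).
    have A0 : 0 <= 2 / (alpha * ln 2) * ln e^-1.
      by rewrite mulr_ge0// divr_ge0// ltW.
    have -> : 2 * ln e^-1 * ln 2 = 2 / (alpha * ln 2) * ln e^-1 * (alpha * ln 2 ^+ 2).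
      by field; rewrite !gt_eqF.
    by rewrite sqrtrM// (sqrtrM _ (ltW alpha_gt0)) sqrtr_sqr gtr0_norm.
  have sa : Num.sqrt alpha != 0 by rewrite gt_eqF// sqrtr_gt0.
  by rewrite le_eqVlt; apply/orP; left; apply/eqP; field.
pose h : R := 2 `^ ((1 - beta) / 2).
have h1 : h < 1 by rewrite powR2_lt1// ltr_pdivrMr// mul0r subr_lt0.
have h0 : 0 <= h by exact: powR_ge0.
exists (((1 - h)^-1) ^+ 2); first exact: sqr_ge0.
near=> e; rewrite /rate b1 mulrC ler_wpM2r ?sqr_ge0// ler_sqr ?nnegrE.
- by rewrite geometric_sum_le// h0.
- by rewrite sumr_ge0// => i _; rewrite exprn_ge0.
- by rewrite invr_ge0 subr_ge0 ltW.
Unshelve. all: by end_near. Qed.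

End ClosedForm.

(** * The allocation, the total number of samples, and the cost upper bound *)

Section Cost.
Context (R : realType) (k : ml_kind) (alpha beta V1 sigma ct : R) (Ku : nat).
Hypotheses (alpha_gt0 : 0 < alpha) (beta_gt0 : 0 < beta) (V1_gt0 : 0 < V1)
  (sigma_gt0 : 0 < sigma) (ct_gt0 : 0 < ct) (Ku_gt0 : (0 < Ku)%N).

Let Ku0 : 0 < Ku%:R :> R. Proof. by rewrite ltr0n. Qed.

Local Notation theta := (theta_eps k alpha beta V1 sigma ct Ku).
Local Notation A := (weight_A k alpha).
Local Notation q0 := (opt_q0 k alpha beta V1 sigma Ku).
Local Notation mu := (opt_mu k alpha beta V1 sigma Ku).
Local Notation q := (opt_q k alpha beta V1 sigma Ku).

(** Up to the weight, the unnormalized q_r is kap g^(r-1). The number of inner samples doubles at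
    each level, so the inner cost carries the ratio h = 2 g. *)
Let kap : R := Num.sqrt V1 / Ku%:R `^ (beta / 2).
Let g : R := 2 `^ (- ((1 + beta) / 2)).
Let h : R := 2 `^ ((1 - beta) / 2).

Let kap_gt0 : 0 < kap. Proof. by rewrite divr_gt0 ?sqrtr_gt0 ?powR_gt0. Qed.
Let g_gt0 : 0 < g. Proof. exact: powR_gt0. Qed.
Let h_gt0 : 0 < h. Proof. exact: powR_gt0. Qed.
Let g_lt1 : g < 1.
Proof. by rewrite powR2_lt1// oppr_lt0 divr_gt0// addr_gt0. Qed.
Let g2 : g * 2 = h.
Proof.
by rewrite -[X in g * X]powRr1// -powRD_gt0//; congr (_ `^ _); field.
Qed.

Lemma weight_A_bound : exists2 C, 0 <= C & forall n r, (1 <= r <= n)%N -> `|A n r| <= C.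
Proof.
rewrite /weight_A; case: (k).
  by exists 1 => // n r _; rewrite normr1.
exists (weight_bound alpha / (1 - 2 `^ (- alpha))).
  rewrite divr_ge0 ?weight_bound_ge0// subr_ge0 ltW// powR2_lt1//.
  by rewrite oppr_lt0.
by move=> n r rn; rewrite normr_weight_W_le.
Qed.

Lemma weight_A_lim m : exists N, forall n r, (N <= n)%N -> (1 <= r <= m)%N ->
  2^-1 <= `|A n r|.
Proof.
elim: m => [|m [N IH]].
  by exists 0%N => n r _ /andP[r1 r0]; move: (leq_trans r1 r0).
have [N' HN'] : exists N', forall n, (N' <= n)%N -> 2^-1 <= `|A n m.+1|.
  rewrite /weight_A; case: (k); last exact: weight_W_lim.
  by exists 0%N => n _; rewrite normr1 invf_le1// ler1n.
exists (maxn N N') => n r; rewrite geq_max => /andP[Nn N'n] /andP[r1].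
rewrite leq_eqVlt => /predU1P[->|rm]; first exact: HN'.
by apply: IH => //; rewrite r1.
Qed.

Lemma opt_q0_1 n : q0 n 1 = sigma. Proof. by []. Qed.

Lemma opt_q0E n r : (1 < r)%N -> q0 n r = kap * `|A n r| * g ^+ r.-1.
Proof.
move=> r1; rewrite /opt_q0 gtn_eqF// /kap invfM mulrACA mulrA; congr (_ * _).
rewrite -powRN -powR_mulrn ?powR_ge0// -powRrM; congr (_ `^ _).
by case: r r1 => // r _ /=; rewrite -natr1; field.
Qed.

Lemma opt_q0_ge0 n r : 0 <= q0 n r.
Proof.
rewrite /opt_q0; case: ifP => _; first exact: ltW.
by rewrite divr_ge0 ?mulr_ge0 ?sqrtr_ge0 ?powR_ge0.
Qed.

Lemma opt_mu_ge n : (0 < n)%N -> sigma <= mu n.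
Proof.
move=> n0; rewrite /opt_mu big_ltn// opt_q0_1 lerDl sumr_ge0// => r _.
exact: opt_q0_ge0.
Qed.

Lemma opt_mu_gt0 n : (0 < n)%N -> 0 < mu n.
Proof. by move=> n0; rewrite (lt_le_trans sigma_gt0)// opt_mu_ge. Qed.

Lemma opt_mu_bound : exists2 C, 0 < C & forall n, (0 < n)%N -> mu n <= C.
Proof.
have [C C0 HC] := weight_A_bound.
exists (sigma + kap * C * (1 - g)^-1).
  by rewrite ltr_wpDr// !mulr_ge0 ?(ltW kap_gt0)// invr_ge0 subr_ge0 ltW.
move=> n n0; rewrite /opt_mu big_ltn// lerD2l.
apply: (@le_trans _ _ (\sum_(2 <= r < n.+1) kap * C * g ^+ r.-1)).
  apply: ler_sum_nat => r /andP[r1 rn]; rewrite opt_q0E//.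
  rewrite ler_wpM2r ?exprn_ge0 ?(ltW g_gt0)// ler_wpM2l ?(ltW kap_gt0)// HC//.
  by rewrite (ltnW r1).
rewrite -mulr_sumr ler_wpM2l ?mulr_ge0 ?(ltW kap_gt0)// big_add1 /=.
by rewrite geometric_sum_le// (ltW g_gt0).
Qed.

Definition level_cost n : R := \sum_(1 <= r < n.+1) q0 n r * 2 ^+ r.-1.

Lemma level_costE n : (0 < n)%N ->
  level_cost n = sigma + kap * \sum_(2 <= r < n.+1) `|A n r| * h ^+ r.-1.
Proof.
move=> n0; rewrite /level_cost big_ltn// opt_q0_1 expr0 mulr1 mulr_sumr; congr (_ + _).
apply: eq_big_nat => r /andP[r1 _].
by rewrite opt_q0E// -g2 exprMn !mulrA.
Qed.

Lemma level_cost_ge n : (0 < n)%N -> sigma <= level_cost n.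
Proof.
move=> n0; rewrite level_costE// lerDl mulr_ge0 ?(ltW kap_gt0)// sumr_ge0// => r _.
by rewrite mulr_ge0// exprn_ge0// ltW.
Qed.

Lemma level_cost_le : exists2 C, 0 <= C &
  forall n, (0 < n)%N -> level_cost n <= C * level_geom beta n.
Proof.
have [C C0 HC] := weight_A_bound.
exists (sigma + kap * C); first by rewrite addr_ge0 ?mulr_ge0 ?(ltW sigma_gt0) ?(ltW kap_gt0).
move=> n n0; rewrite level_costE// mulrDl lerD//.
  rewrite /level_geom big_ltn// expr0 mulrDr mulr1 lerDl mulr_ge0 ?(ltW sigma_gt0)//.
  by rewrite sumr_ge0// => i _; rewrite exprn_ge0// powR_ge0.
rewrite -(mulrA kap) ler_wpM2l ?(ltW kap_gt0)//.
apply: (@le_trans _ _ (\sum_(2 <= r < n.+1) C * h ^+ r.-1)).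
  apply: ler_sum_nat => r /andP[r1 rn].
  by rewrite ler_wpM2r ?exprn_ge0 ?(ltW h_gt0)// HC// (ltnW r1).
rewrite -mulr_sumr ler_wpM2l// big_add1 /= /level_geom [leRHS]big_ltn//.
by rewrite lerDr exprn_ge0// ltW.
Qed.

(** Here h >= 1, and for large R each of the first levels contributes at least kap / 2. *)
Lemma level_cost_lim : beta <= 1 -> forall B, exists N, forall n, (N <= n)%N ->
  B <= level_cost n.
Proof.
move=> b1 B; have h1 : 1 <= h.
  rewrite -[leLHS](powRr0 2) ler_powR ?ler1n// divr_ge0// subr_ge0//.
(* So many levels that m kap / 2 >= |B|; the + 1 keeps the ceiling's argument positive. *)
pose m := ceiln (`|B| / kap * 2 + 1).
have mP : `|B| / kap * 2 <= m%:R.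
  rewrite (le_trans _ (ceiln_ge _))// ?lerDl// ltr_wpDl// mulr_ge0// divr_ge0//.
  exact: ltW.
have [N HN] := weight_A_lim m.+1.
exists (maxn N m.+1) => n; rewrite geq_max => /andP[Nn mn].
rewrite level_costE; last exact: leq_trans mn.
rewrite (le_trans (ler_norm _))// ler_wpDl ?(ltW sigma_gt0)//.
rewrite mulrC -ler_pdivrMr// (@big_cat_nat _ _ _ m.+2)//=.
apply: ler_wpDr.
  by rewrite sumr_ge0// => i _; rewrite mulr_ge0// exprn_ge0// ltW.
apply: (@le_trans _ _ (\sum_(2 <= r < m.+2) 2^-1)).
  by rewrite sumr_const_nat -[leRHS]mulr_natl subSS subSS subn0 ler_pdivlMr.
apply: ler_sum_nat => r /andP[r1 rm].
rewrite -[leLHS]mulr1 ler_pM ?exprn_ege1// HN// (ltnW r1)//.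
Qed.

Lemma opt_q_sum n : (0 < n)%N -> \sum_(1 <= r < n.+1) q n r = 1.
Proof.
move=> n0; rewrite (eq_big_nat _ _ (F2 := fun r => q0 n r / mu n)).
  by rewrite -mulr_suml divff// gt_eqF// opt_mu_gt0.
by move=> r rn; rewrite /opt_q -ltnS rn.
Qed.

Lemma lev_KE e r : lev_K (theta e) r = (opt_Kn alpha ct Ku k e * 2 ^ r.-1)%N.
Proof. by rewrite /lev_K /= opt_KE ceiln_nat. Qed.

Lemma mean_inner_costE e (n := opt_R k alpha ct Ku e) :
  mean_inner_cost (theta e) = (opt_Kn alpha ct Ku k e)%:R * level_cost n / mu n.
Proof.
rewrite /mean_inner_cost /= opt_KE -/n -mulrA; congr (_ * _).
rewrite /level_cost mulr_suml; apply: eq_big_nat => r rn.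
by rewrite /opt_q -ltnS rn mulrAC.
Qed.

Lemma costE tau e : (0 < opt_R k alpha ct Ku e)%N ->
  cost tau (theta e) = pJ (theta e) * (tau + mean_inner_cost (theta e)).
Proof.
move=> n0; rewrite /cost /mean_inner_cost /=; congr (_ * _).
under eq_bigr do rewrite lev_KE natrM natrX mulrDr mulrCA.
by rewrite big_split /= -mulr_suml opt_q_sum// mul1r -mulr_sumr opt_KE.
Qed.

Lemma opt_M_gt0 n : 0 < opt_M k alpha n.
Proof.
by rewrite /opt_M; case: (k); rewrite ltr_pwDl// invr_ge0 !mulr_ge0// ltW.
Qed.

Lemma opt_M_le n : (0 < n)%N -> opt_M k alpha n <= 1 + (2 * alpha)^-1.
Proof.
move=> n0; rewrite /opt_M; case: (k) => //; rewrite lerD2l.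
have a2 : 0 < 2 * alpha by rewrite mulr_gt0.
have an2 : 0 < 2 * alpha * n%:R by rewrite mulr_gt0 ?ltr0n.
by rewrite lef_pV2// ler_peMr ?ler1n// ltW.
Qed.

Lemma opt_q_gt0 n r : (1 <= r <= n)%N -> r = 1%N \/ A n r != 0 -> 0 < q n r.
Proof.
move=> rn hr; rewrite /opt_q rn divr_gt0 ?opt_mu_gt0//; last first.
  by case/andP: rn => r1; exact: leq_trans.
case/andP: rn; rewrite leq_eqVlt => /predU1P[<-//|r1 _].
case: hr => [r1'|Ar]; first by rewrite r1' in r1.
by rewrite opt_q0E// mulr_gt0 ?exprn_gt0// mulr_gt0 ?normr_gt0.
Qed.

Lemma opt_q_ge0 n r : 0 <= q n r.
Proof.
rewrite /opt_q; case: ifP => // /andP[r1 rn]; rewrite divr_ge0 ?opt_q0_ge0// ltW//.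
by rewrite opt_mu_gt0// (leq_trans r1).
Qed.

Lemma opt_J_gt0 e : 0 < e -> (0 < opt_R k alpha ct Ku e)%N -> 0 < pJ (theta e).
Proof.
move=> e0 n0; rewrite /= /opt_J mulr_gt0 ?divr_gt0 ?opt_M_gt0 ?exprn_gt0//.
rewrite ltr_pwDl ?divr_gt0 ?exprn_gt0//.
  by apply: opt_q_gt0; [rewrite leqnn|left].
rewrite sumr_ge0// => r _; rewrite divr_ge0//.
  by rewrite mulr_ge0 ?sqr_ge0 ?ltW.
by rewrite !mulr_ge0 ?opt_q_ge0 ?powR_ge0.
Qed.

(** The allocation makes the r-th term in J equal to mu times the r-th term of the inner cost, up to
    the factor (Ku / K)^beta <= 1 for r >= 2. *)
Lemma opt_J_le e (n := opt_R k alpha ct Ku e) : 0 < e -> (0 < n)%N ->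
  pJ (theta e) <= opt_M k alpha n / e ^+ 2 * (mu n * level_cost n).
Proof.
move=> e0 n0; rewrite /= /opt_J -/n ler_wpM2l ?divr_ge0 ?(ltW (opt_M_gt0 _)) ?sqr_ge0//.
have mu0 := opt_mu_gt0 n0.
rewrite level_costE// mulrDr mulr_sumr mulr_sumr; apply: lerD.
  rewrite /opt_q n0 /= opt_q0_1 expr2 invfM invrK.
  by rewrite mulrACA divff ?gt_eqF// mul1r mulrC.
apply: ler_sum_nat => r /andP[r1 rn].
have rn' : (1 <= r <= n)%N by rewrite (ltnW r1).
rewrite /opt_q rn' opt_q0E//.
(* A vanishing weight also makes q_r vanish; both sides are then 0. *)
have [->|A0] := eqVneq (A n r) 0.
  by rewrite expr2 !mul0r normr0 !(mul0r, mulr0).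
have Ap : 0 < `|A n r| by rewrite normr_gt0.
have KK : (Ku%:R : R) `^ beta <= opt_K k alpha ct Ku e `^ beta.
  by rewrite opt_KE ge0_ler_powR ?nnegrE ?(ltW beta_gt0)// ler_nat opt_Kn_ge.
have Kb0 : 0 < (Ku%:R : R) `^ beta by exact: powR_gt0.
have pE : 2 `^ ((r%:R - 1) * beta) = (g ^+ r.-1 * h ^+ r.-1)^-1.
  rewrite -exprMn -powRD_gt0// -powR_mulrn ?powR_ge0// -powRrM -powRN.
  by case: r r1 {rn rn' Ap A0} => // r _ /=; rewrite -natr1; congr (_ `^ _); field.
rewrite pE; set gr := g ^+ _; set hr := h ^+ _.
have gr0 : 0 < gr by rewrite exprn_gt0.
have hr0 : 0 < hr by rewrite exprn_gt0.
have V1E : V1 = kap ^+ 2 * Ku%:R `^ beta.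
  rewrite /kap expr_div_n sqr_sqrtr ?(ltW V1_gt0)// -[_ ^+ 2 in X in _ / X]powR_mulrn ?powR_ge0//.
  by rewrite -powRrM divfK ?divfK ?gt_eqF// ?powR_gt0.
have -> : A n r ^+ 2 * V1 = `|A n r| ^+ 2 * (kap ^+ 2 * Ku%:R `^ beta).
  by rewrite -V1E real_normK// num_real.
set K := opt_K _ _ _ _ _ in KK *.
have K0 : 0 < K `^ beta by rewrite (lt_le_trans Kb0).
rewrite [leLHS](_ : _ = mu n * (kap * (`|A n r| * hr)) * (Ku%:R `^ beta / K `^ beta)).
  by rewrite ler_piMr ?mulr_ge0 ?(ltW mu0) ?(ltW kap_gt0) ?(ltW hr0)// ler_pdivrMr// mul1r.
by field; rewrite !gt_eqF.
Qed.

Lemma opt_Kn_le_near :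
  \forall e \near (0 : R)^'+, (opt_Kn alpha ct Ku k e <= Ku * 2)%N.
Proof.
case: (k); last exact: opt_Kn_ML2R.
have := opt_Kn_MLMC alpha_gt0 ct_gt0 Ku_gt0; apply: filterS => e ->.
by rewrite leq_pmulr.
Qed.

Lemma cost_le tau : 0 <= tau -> exists2 C, 0 <= C &
  \forall e \near (0 : R)^'+, 0 < e /\ cost tau (theta e) <=
    C * level_geom beta (opt_R k alpha ct Ku e) ^+ 2 / e ^+ 2.
Proof.
move=> tau0; have [m m0 Hm] := opt_mu_bound; have [D D0 HD] := level_cost_le.
pose M := 1 + (2 * alpha)^-1.
have M0 : 0 <= M by rewrite addr_ge0// invr_ge0 mulr_ge0// ltW.
(* After cancelling mu, the bound involves tau mu + K times the level cost; the first term is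
   absorbed because the level cost is at least sigma. *)
pose C1 := tau * m / sigma + (Ku * 2)%:R.
have C10 : 0 <= C1 by rewrite addr_ge0// divr_ge0 ?mulr_ge0// ltW.
exists (M * C1 * D ^+ 2); first by rewrite !mulr_ge0 ?sqr_ge0.
near=> e; have e0 : 0 < e by [].
split=> //.
have n0 : (0 < opt_R k alpha ct Ku e)%N.
  by near: e; exact: (opt_R_near ct Ku alpha_gt0 k 1).
set n := opt_R _ _ _ _ _ in n0 *.
have KK : (opt_Kn alpha ct Ku k e <= Ku * 2)%N by near: e; exact: opt_Kn_le_near.
rewrite costE// mean_inner_costE -/n.
have mu0 := opt_mu_gt0 n0; have mum := Hm n n0; have LD := HD n n0.
have L0 := level_cost_ge n0; have Lp : 0 < level_cost n := lt_le_trans sigma_gt0 L0.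
have Mn := opt_M_le n0; have Mn0 := opt_M_gt0 n.
have K0 : 0 <= (opt_Kn alpha ct Ku k e)%:R :> R by [].
have Kle : (opt_Kn alpha ct Ku k e)%:R <= (Ku * 2)%:R :> R by rewrite ler_nat.
move: (opt_Kn alpha ct Ku k e)%:R K0 Kle => K K0 Kle.
have tK0 : 0 <= tau + K * level_cost n / mu n.
  by rewrite addr_ge0// divr_ge0 ?mulr_ge0// ltW.
apply: (le_trans (ler_wpM2r tK0 (opt_J_le e0 n0))); rewrite -/n.
rewrite [leLHS](_ : _ = opt_M k alpha n *
    (level_cost n * (tau * mu n + K * level_cost n)) / e ^+ 2); last first.
  by field; rewrite !gt_eqF.
rewrite ler_wpM2r ?invr_ge0 ?sqr_ge0// -!mulrA.
have tm0 : 0 <= tau * mu n by rewrite mulr_ge0// ltW.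
have KL0 : 0 <= K * level_cost n by rewrite mulr_ge0// ltW.
apply: ler_pM => //; [exact: ltW|by rewrite mulr_ge0 ?addr_ge0// ltW|].
apply: (@le_trans _ _ (C1 * level_cost n ^+ 2)).
  rewrite mulrC [level_cost n ^+ 2]expr2 mulrA ler_wpM2r ?(ltW Lp)// /C1 mulrDl lerD//.
    apply: (@le_trans _ _ (tau * m)); first by rewrite ler_wpM2l.
    by rewrite -[leLHS]mulr1 -[leRHS]mulrA ler_wpM2l ?mulr_ge0 ?(ltW m0)// mulrC ler_pdivlMr// mul1r.
  by rewrite ler_wpM2r// ltW.
rewrite ler_wpM2l// mulrA -expr2 -exprMn ler_sqr ?nnegrE ?(ltW Lp)//.
exact: le_trans (ltW Lp) LD.
Unshelve. all: by end_near. Qed.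

Lemma rate_ge0_near : \forall e \near (0 : R)^'+, 0 <= rate k alpha beta e.
Proof.
near=> e; have [e0 L0] : 0 < e /\ 0 <= ln e^-1 by near: e; exact: ln_inv_near.
rewrite /rate; case: ifP => _; first exact: sqr_ge0.
case: (k); case: ifP => _.
- by rewrite mulr_ge0 ?invr_ge0 ?sqr_ge0.
- exact: powR_ge0.
- by rewrite mulr_ge0 ?invr_ge0 ?sqr_ge0.
- by rewrite mulr_ge0 ?expR_ge0 ?sqr_ge0.
Unshelve. all: by end_near. Qed.

Lemma rate_cost_le tau : 0 <= tau -> exists2 C, 0 <= C &
  (limsup0 (fun e => (rate k alpha beta e * cost tau (theta e))%:E) <= C%:E)%E.
Proof.
move=> tau0; have [C C0 HC] := cost_le tau0.
have [D D0 HD] := rate_level_geom ct Ku alpha_gt0 k beta.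
exists (C * D); first exact: mulr_ge0.
apply: limsup0_le_near; near=> e; rewrite lee_fin.
have [e0 ce] : 0 < e /\ cost tau (theta e) <=
    C * level_geom beta (opt_R k alpha ct Ku e) ^+ 2 / e ^+ 2 by near: e.
have r0 : 0 <= rate k alpha beta e by near: e; exact: rate_ge0_near.
apply: (le_trans (ler_wpM2l r0 ce)).
rewrite mulrA ler_pdivrMr ?exprn_gt0// mulrCA -mulrA ler_wpM2l//.
by near: e.
Unshelve. all: by end_near. Qed.

End Cost.

(** * Comparison of the costs for tau and for 0 *)

Section CostComparison.
Context (R : realType) (alpha beta V1 sigma ct : R) (Ku : nat).
Hypotheses (alpha_gt0 : 0 < alpha) (beta_gt0 : 0 < beta) (V1_gt0 : 0 < V1)
  (sigma_gt0 : 0 < sigma) (ct_gt0 : 0 < ct) (Ku_gt0 : (0 < Ku)%N).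

Local Notation theta k := (theta_eps k alpha beta V1 sigma ct Ku).
Local Notation mu k := (opt_mu k alpha beta V1 sigma Ku).
Local Notation lc k := (level_cost k alpha beta V1 sigma Ku).

Lemma mean_inner_cost_gt0 k :
  \forall e \near (0 : R)^'+, 0 < mean_inner_cost (theta k e).
Proof.
near=> e; have e0 : 0 < e by [].
have n0 : (0 < opt_R k alpha ct Ku e)%N.
  by near: e; exact: (opt_R_near ct Ku alpha_gt0 k 1).
rewrite mean_inner_costE divr_gt0 ?opt_mu_gt0// mulr_gt0//.
  by rewrite ltr0n (leq_trans Ku_gt0)// opt_Kn_ge.
by rewrite (lt_le_trans sigma_gt0)// level_cost_ge.
Unshelve. all: by end_near. Qed.

Lemma cost_ratio k tau : \forall e \near (0 : R)^'+,
  cost tau (theta k e) = (tau / mean_inner_cost (theta k e) + 1) * cost 0 (theta k e).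
Proof.
near=> e.
have n0 : (0 < opt_R k alpha ct Ku e)%N.
  by near: e; exact: (opt_R_near ct Ku alpha_gt0 k 1).
have m0 : 0 < mean_inner_cost (theta k e) by near: e; exact: mean_inner_cost_gt0.
rewrite !costE// add0r mulrCA; congr (_ * _).
by rewrite mulrDl mul1r divfK ?gt_eqF.
Unshelve. all: by end_near. Qed.

Lemma mean_inner_cost_ge k : exists2 C, 0 < C & \forall e \near (0 : R)^'+,
  C * lc k (opt_R k alpha ct Ku e) <= mean_inner_cost (theta k e).
Proof.
have [m m0 Hm] := opt_mu_bound k alpha_gt0 beta_gt0 V1_gt0 sigma_gt0 Ku_gt0.
exists (Ku%:R / m); first by rewrite divr_gt0// ltr0n.
near=> e; have e0 : 0 < e by [].
have n0 : (0 < opt_R k alpha ct Ku e)%N.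
  by near: e; exact: (opt_R_near ct Ku alpha_gt0 k 1).
have L0 : 0 < lc k (opt_R k alpha ct Ku e).
  by rewrite (lt_le_trans sigma_gt0)// level_cost_ge.
rewrite mean_inner_costE mulrAC; apply: ler_pM.
- by rewrite mulr_ge0// ltW.
- by rewrite invr_ge0 ltW.
- by rewrite ler_wpM2r ?(ltW L0)// ler_nat opt_Kn_ge.
- by rewrite lef_pV2 ?posrE ?opt_mu_gt0// Hm.
Unshelve. all: by end_near. Qed.

Lemma mean_inner_cost_dvg k A : beta <= 1 ->
  \forall e \near (0 : R)^'+, A <= mean_inner_cost (theta k e).
Proof.
move=> b1; have [C C0 HC] := mean_inner_cost_ge k.
have [N HN] := level_cost_lim k alpha_gt0 V1_gt0 sigma_gt0 Ku_gt0 b1 (A / C).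
near=> e.
apply: (@le_trans _ _ (C * lc k (opt_R k alpha ct Ku e))); last first.
  by near: e; exact: HC.
rewrite mulrC -ler_pdivrMr// HN//.
by near: e; exact: (opt_R_near ct Ku alpha_gt0 k N).
Unshelve. all: by end_near. Qed.

Lemma cost_ratio_cvg k (tau dinf : R) :
  (1 < beta -> 0 < dinf /\ mean_inner_cost (theta k e) @[e --> 0^'+] --> dinf) ->
  tau / mean_inner_cost (theta k e) + 1 @[e --> 0^'+] --> cost_factor beta tau dinf.
Proof.
rewrite /cost_factor leNgt; case: ltP => [b1 /(_ isT) [d0 md] | b1 _] /=.
  apply: cvgD; last exact: cvg_cst.
  by apply: cvgMr; apply: cvgV => //; rewrite gt_eqF.
rewrite -[X in _ --> X]add0r; apply: cvgD; last exact: cvg_cst.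
apply/cvgrPdist_le => d d0; near=> e.
have m0 : 0 < mean_inner_cost (theta k e) by near: e; exact: mean_inner_cost_gt0.
rewrite sub0r normrN normrM normfV (gtr0_norm m0) ler_pdivrMr// mulrC -ler_pdivrMr//.
by near: e; exact: mean_inner_cost_dvg.
Unshelve. all: by end_near. Qed.

Lemma limsup0_cost_le k (tau dinf : R) (v : R -> R) : 0 <= tau ->
  (1 < beta -> 0 < dinf /\ mean_inner_cost (theta k e) @[e --> 0^'+] --> dinf) ->
  (limsup0 (fun e => (v e * cost 0 (theta k e))%:E) < +oo)%E ->
  (limsup0 (fun e => (v e * cost tau (theta k e))%:E) <=
   (cost_factor beta tau dinf)%:E * limsup0 (fun e => (v e * cost 0 (theta k e))%:E))%E.
Proof.
move=> tau0 hd voo.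
apply: (limsup0_le_mul_cvg _ _ (cost_ratio_cvg (tau := tau) hd) voo).
  rewrite /cost_factor; case: ifPn => // ; rewrite -ltNge => b1.
  by rewrite ltr_wpDl// divr_ge0// ltW//; case: (hd b1).
by apply: filterS (cost_ratio k tau) => e ->; rewrite mulrCA.
Qed.

(** Near 0 one has K = Ku and all weights are 1, so the mean inner cost is Ku times a quotient of
    two convergent geometric sums, of ratios h and g. *)
Lemma mean_inner_cost_MLMC_cvg : 1 < beta -> exists2 dinf : R, 0 < dinf &
  mean_inner_cost (theta MLMC e) @[e --> 0^'+] --> dinf.
Proof.
move=> b1; set kap := Num.sqrt V1 / Ku%:R `^ (beta / 2).
pose S (x : R) := sigma + kap * (x / (1 - x)).
have kap0 : 0 < kap by rewrite divr_gt0 ?sqrtr_gt0 ?powR_gt0// ltr0n.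
pose g : R := 2 `^ (- ((1 + beta) / 2)); pose h : R := 2 `^ ((1 - beta) / 2).
have g1 : g < 1 by rewrite powR2_lt1// oppr_lt0 divr_gt0// addr_gt0.
have h1 : h < 1 by rewrite powR2_lt1// ltr_pdivrMr// mul0r subr_lt0.
have S0 x : 0 <= x -> x < 1 -> 0 < S x.
  move=> x0 x1; have x1' : 0 <= 1 - x by rewrite subr_ge0 ltW.
  by rewrite ltr_wpDr// mulr_ge0 ?(ltW kap0)// divr_ge0.
have cvgS x : 0 <= x -> x < 1 ->
    sigma + kap * \sum_(2 <= r < n.+1) x ^+ r.-1 @[n --> \oo] --> S x.
  move=> x0 x1; apply: cvgD; first exact: cvg_cst.
  apply: cvgMr; rewrite -(cvg_shiftS (fun n => \sum_(2 <= r < n.+1) x ^+ r.-1)).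
  have := @cvg_geometric_series R x x; rewrite ger0_norm// => /(_ x1).
  apply: cvg_trans; apply: near_eq_cvg; near=> n.
  rewrite /series /= big_add1 /= big_add1 /=.
  by apply: eq_bigr => i _; rewrite exprS.
have Rcvg : opt_R MLMC alpha ct Ku e @[e --> 0^'+] --> \oo.
  by apply/cvgnyPge => N; exact: (opt_R_near ct Ku alpha_gt0 MLMC N).
exists (Ku%:R * S h / S g).
  by rewrite divr_gt0 ?mulr_gt0 ?ltr0n ?S0 ?powR_ge0.
have H : Ku%:R * (sigma + kap * \sum_(2 <= r < n.+1) h ^+ r.-1)
    / (sigma + kap * \sum_(2 <= r < n.+1) g ^+ r.-1) @[n --> \oo] --> Ku%:R * S h / S g.
  apply: cvgM; first by apply: cvgMr; apply: cvgS; rewrite ?powR_ge0.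
  by apply: cvgV; [rewrite gt_eqF// S0 ?powR_ge0|apply: cvgS; rewrite ?powR_ge0].
have := cvg_comp _ _ Rcvg H; apply: cvg_trans; apply: near_eq_cvg; near=> e => /=.
have n0 : (0 < opt_R MLMC alpha ct Ku e)%N.
  by near: e; exact: (opt_R_near ct Ku alpha_gt0 MLMC 1).
have KE : opt_Kn alpha ct Ku MLMC e = Ku by near: e; exact: opt_Kn_MLMC.
rewrite mean_inner_costE KE level_costE//; congr (_ * _ / _).
  by congr (_ + _ * _); apply: eq_bigr => r _ /=; rewrite normr1 mul1r.
rewrite /opt_mu [RHS]big_ltn// opt_q0_1 mulr_sumr; congr (_ + _).
by apply: eq_big_nat => r /andP[r1 _]; rewrite opt_q0E//= normr1 mulr1.
Unshelve. all: by end_near. Qed.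

(** Only an upper bound on tau / d is needed, and the lower limit of d supplies one up to any slack.
    Nonnegativity of v then allows the cost ratio to be replaced by that bound. *)
Lemma limsup0_cost_ML2R_le tau : 0 <= tau -> 1 < beta -> exists2 dinf : R,
  0 < dinf /\
  limf_einf (fun e => (mean_inner_cost (theta ML2R e))%:E) 0^'+ = dinf%:E &
  forall v : R -> R, (\forall e \near 0^'+, 0 <= v e) ->
    (limsup0 (fun e => (v e * cost 0 (theta ML2R e))%:E) < +oo)%E ->
    (limsup0 (fun e => (v e * cost tau (theta ML2R e))%:E) <=
     (cost_factor beta tau dinf)%:E *
     limsup0 (fun e => (v e * cost 0 (theta ML2R e))%:E))%E.
Proof.
move=> tau0 b1.
have [C C0 HC] := mean_inner_cost_ge ML2R.
have [D D0 HD] := level_cost_le ML2R beta alpha_gt0 V1_gt0 sigma_gt0 Ku_gt0.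
pose h : R := 2 `^ ((1 - beta) / 2).
have h1 : h < 1 by rewrite powR2_lt1// ltr_pdivrMr// mul0r subr_lt0.
have h0 : 0 <= h by exact: powR_ge0.
have Cs : 0 < C * sigma by rewrite mulr_gt0.
have mab : \forall e \near (0 : R)^'+, C * sigma <=
    mean_inner_cost (theta ML2R e) <= (Ku * 2)%:R * (D * (1 - h)^-1) / sigma.
  near=> e.
  have n0 : (0 < opt_R ML2R alpha ct Ku e)%N.
    by near: e; exact: (opt_R_near ct Ku alpha_gt0 ML2R 1).
  have L0 : 0 <= lc ML2R (opt_R ML2R alpha ct Ku e).
    by rewrite (le_trans (ltW sigma_gt0))// level_cost_ge.
  apply/andP; split.
    apply: (@le_trans _ _ (C * lc ML2R (opt_R ML2R alpha ct Ku e))); last first.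
      by near: e; exact: HC.
    by rewrite ler_wpM2l ?(ltW C0)// level_cost_ge.
  rewrite mean_inner_costE; apply: ler_pM.
  - by rewrite mulr_ge0.
  - by rewrite invr_ge0 ltW// opt_mu_gt0.
  - apply: ler_pM => //.
      by rewrite ler_nat; near: e; exact: opt_Kn_ML2R.
    by rewrite (le_trans (HD _ n0))// ler_wpM2l// geometric_sum_le// h0.
  - by rewrite lef_pV2 ?posrE ?opt_mu_gt0// opt_mu_ge.
have [dinf dC dE] := liminf0_itv mab.
have d0 : 0 < dinf by exact: lt_le_trans dC.
have bn : (beta <= 1) = false by rewrite leNgt b1.
exists dinf => // v v0 voo; rewrite /cost_factor bn.
have k0 : 0 < tau / dinf + 1 by rewrite ltr_wpDl// divr_ge0// ltW.
apply: (limsup0_le_mul k0 voo) => M d dp gM.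
have g0 : \forall e \near (0 : R)^'+, 0 <= v e * cost 0 (theta ML2R e).
  near=> e; have e0 : 0 < e by [].
  have n0 : (0 < opt_R ML2R alpha ct Ku e)%N.
    by near: e; exact: (opt_R_near ct Ku alpha_gt0 ML2R 1).
  have m0 : 0 < mean_inner_cost (theta ML2R e) by near: e; exact: mean_inner_cost_gt0.
  rewrite mulr_ge0//; first by near: e.
  by rewrite costE// mulr_ge0 ?add0r ?(ltW m0)// ltW// opt_J_gt0.
(* The two eventual properties hold together at some point. *)
have M0 : 0 <= M.
  have [e [ge0 geM]] := @filter_ex _ _ (at_right_proper_filter (0 : R)) _ (filterI g0 gM).
  exact: le_trans geM.
(* The slack d / (M + 1) remains at most d after multiplication by M. *)
have ratio : \forall e \near (0 : R)^'+,
    tau / mean_inner_cost (theta ML2R e) <= tau / dinf + d / (M + 1).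
  move: tau0; rewrite le_eqVlt => /predU1P[<-|tp].
    near=> e; rewrite !mul0r add0r divr_ge0 ?(ltW dp)// addr_ge0//.
  set z := tau / dinf + d / (M + 1).
  have z0 : tau / dinf < z by rewrite ltrDl divr_gt0// ltr_wpDl.
  have zp : 0 < z by rewrite (lt_trans _ z0)// divr_gt0.
  have := @liminf0_lt_near _ (fun e => mean_inner_cost (theta ML2R e)) (tau / z).
  rewrite dE lte_fin ltr_pdivrMr// mulrC -ltr_pdivrMr// => /(_ z0) H.
  near=> e.
  have m0 : 0 < mean_inner_cost (theta ML2R e) by near: e; exact: mean_inner_cost_gt0.
  by rewrite ler_pdivrMr// mulrC -ler_pdivrMr//; near: e.
near=> e.
have -> : cost tau (theta ML2R e) =
   (tau / mean_inner_cost (theta ML2R e) + 1) * cost 0 (theta ML2R e).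
  by near: e; exact: cost_ratio.
have ge : 0 <= v e * cost 0 (theta ML2R e) <= M.
  by apply/andP; split; near: e.
have re : tau / mean_inner_cost (theta ML2R e) <= tau / dinf + d / (M + 1).
  by near: e.
rewrite mulrCA; case/andP: ge => ge0 geM.
apply: (@le_trans _ _ ((tau / dinf + d / (M + 1) + 1) * M)).
  apply: ler_pM => //; last by rewrite lerD2r.
  rewrite addr_ge0// divr_ge0// ltW//.
  by near: e; exact: mean_inner_cost_gt0.
rewrite addrAC mulrDl lerD2l -[leRHS]mulr1 -mulrA ler_wpM2l ?(ltW dp)//.
by rewrite ler_pdivrMl ?ltr_wpDl// mulr1 lerDl.
Unshelve. all: by end_near. Qed.

End CostComparison.

(** * Variance, bias and mean square error at the closed-form parameters *)

Section MeanSquareError.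
Context (R : realType) (d d' : measure_display) (T : measurableType d)
  (P : probability T R) (T' : measurableType d') (P' : probability T' R)
  (Y : T -> R) (YN DY : nat -> T -> R)
  (alpha beta V1 sigma ct : R) (Ku : nat).
Hypotheses (LYN : forall N, (0 < N)%N -> YN N \in Lfun P 2%:E)
  (LDY : forall N, (0 < N)%N -> DY (2 * N)%N \in Lfun P 2%:E)
  (EDY : forall N, (0 < N)%N ->
    ('E_P[DY (2 * N)%N] = 'E_P[YN (2 * N)%N \- YN N])%E)
  (varY : var_bound P YN DY beta V1 sigma).
Hypotheses (alpha_gt0 : 0 < alpha) (beta_gt0 : 0 < beta) (V1_gt0 : 0 < V1)
  (sigma_gt0 : 0 < sigma) (ct_gt0 : 0 < ct) (Ku_gt0 : (0 < Ku)%N).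

Local Notation theta k := (theta_eps k alpha beta V1 sigma ct Ku).
Local Notation nR k := (opt_R k alpha ct Ku).

Definition mean_YN N : R := fine 'E_P[YN N]%E.

Definition level_mean (K r : nat) : R :=
  if r == 1%N then mean_YN K else mean_YN (K * 2 ^ r.-1) - mean_YN (K * 2 ^ r.-2).

Lemma mean_YNE N : (0 < N)%N -> ('E_P[YN N] = (mean_YN N)%:E)%E.
Proof. by move=> N0; rewrite fineK// expectation_fin_num// Lfun12// LYN. Qed.

(** The estimator gives level 1 the coefficient 1 outright; [weight_W1] reconciles this with W_1 in
    the ML2R case. *)
Let B k n r := if r == 1%N then 1 else weight_A k alpha n r.

(** With J_r >= J q_r the sum is at most S / J, where S is the same sum with q_r for J_r, and J was
    defined as M S / eps^2. *)
Lemma level_variance_le k e (n := nR k e) : 0 < e -> (0 < n)%N ->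
  \sum_(1 <= r < n.+1) B k n r ^+ 2 *
    (if r == 1%N then sigma ^+ 2 else V1 * (lev_K (theta k e) r)%:R `^ (- beta))
    / (lev_J (theta k e) r)%:R <= e ^+ 2 / opt_M k alpha n.
Proof.
move=> e0 n0.
have J0 : 0 < pJ (theta k e) by exact: opt_J_gt0.
have M0 := opt_M_gt0 k alpha_gt0 n.
have q1 : 0 < opt_q k alpha beta V1 sigma Ku n 1 by apply: opt_q_gt0 => //; left.
pose J := pJ (theta k e).
pose S := \sum_(1 <= r < n.+1) B k n r ^+ 2 *
    (if r == 1%N then sigma ^+ 2 else V1 * (lev_K (theta k e) r)%:R `^ (- beta))
    / (opt_q k alpha beta V1 sigma Ku n r).
have JE : J = opt_M k alpha n / e ^+ 2 * S.
  rewrite /J /= /opt_J -/n /S [in RHS]big_ltn// /B /= expr1n mul1r; congr (_ * (_ + _)).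
  apply: eq_big_nat => r /andP[r1 _].
  have -> : (lev_K (theta k e) r)%:R `^ (- beta) =
      (opt_K k alpha ct Ku e `^ beta)^-1 * (2 `^ ((r%:R - 1) * beta))^-1.
    rewrite lev_KE natrM natrX powRM ?exprn_ge0// opt_KE !powRN; congr (_ * _^-1).
    rewrite -powR_mulrn// -powRrM.
    by congr (_ `^ _); case: r r1 => // r _ /=; rewrite -natr1; ring.
  by rewrite gtn_eqF// !invfM; ring.
have S0 : S != 0.
  by apply: contraTneq J0 => S0; rewrite -/J JE S0 mulr0 ltxx.
apply: (@le_trans _ _ (S / J)); last first.
  by rewrite JE le_eqVlt; apply/orP; left; apply/eqP; field; rewrite S0 !gt_eqF.
rewrite /S mulr_suml; apply: ler_sum_nat => r rn.
have v0 : 0 <= (if r == 1%N then sigma ^+ 2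
    else V1 * (lev_K (theta k e) r)%:R `^ (- beta)).
  by case: ifP => _; rewrite ?sqr_ge0// mulr_ge0 ?powR_ge0// ltW.
rewrite -[leRHS]mulrA; have [->|B0] := eqVneq (B k n r) 0.
  by rewrite expr2 !mul0r.
rewrite ler_wpM2l//; first exact: mulr_ge0 (sqr_ge0 _) v0.
have q0 : 0 < opt_q k alpha beta V1 sigma Ku n r.
  apply: opt_q_gt0 => //.
  by move: B0; rewrite /B; case: (eqVneq r 1%N) => [->|_ A0]; [left|right].
have Jq : 0 < J * opt_q k alpha beta V1 sigma Ku n r by exact: mulr_gt0.
have Jr : 0 < (lev_J (theta k e) r)%:R :> R by rewrite ltr0n ceiln_gt0.
by rewrite -invfM mulrC lef_pV2 ?posrE// ceiln_ge.
Qed.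

Lemma mse_theta_le k e (Z : nat -> nat -> T' -> R) (n := nR k e)
    (K := opt_Kn alpha ct Ku k e) : 0 < e -> (0 < n)%N ->
  indep_copies P P' YN DY (theta k e) Z ->
  (mse P P' Y (estimator k alpha (theta k e) Z) <=
   ((fine 'E_P[Y] - \sum_(1 <= r < n.+1) B k n r * level_mean K r) ^+ 2
    + e ^+ 2 / opt_M k alpha n)%R%:E)%E.
Proof.
move=> e0 n0 indZ; have [_ _ HV] := varY.
have K0 : (0 < K)%N by rewrite (leq_trans Ku_gt0)// opt_Kn_ge.
have J0 : 0 < pJ (theta k e) by exact: opt_J_gt0.
apply: (@le_trans _ _ _ _ _ (mse_estimator_le Y (m := level_mean K)
  (v := fun r => if r == 1%N then sigma ^+ 2
    else V1 * (lev_K (theta k e) r)%:R `^ (- beta)) indZ n0 _ _)); last first.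
  rewrite lee_fin; apply: lerD => //; exact: level_variance_le.
- move=> r rn Jr0; rewrite /B; case: eqP => [r1|/eqP r1].
    move: Jr0; rewrite /lev_J r1 => J1.
    have : (0 < ceiln (pJ (theta k e) * pq (theta k e) 1))%N.
      by apply: ceiln_gt0; apply: mulr_gt0 => //; apply: opt_q_gt0 => //; left.
    by rewrite J1.
  apply: contra_eq Jr0 => A0; rewrite -lt0n ceiln_gt0// mulr_gt0//.
  by apply: opt_q_gt0 => //; right.
move=> r /andP[r1 rn]; rewrite /level_mean !lev_KE.
case: (eqVneq r 1%N) => [_|rn1].
  rewrite muln1; split; [exact: LYN|exact: mean_YNE|].
  by have [] := HV _ K0.
have {rn1}r2 : (1 < r)%N by rewrite ltn_neqAle eq_sym rn1.
(* For r >= 2 the size K_r is even, as required to use the assumptions on [DY]. *)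
have KE : (K * 2 ^ r.-1 = 2 * (K * 2 ^ r.-2))%N.
  by case: r r2 {r1 rn} => [|[|r]]//= _; rewrite expnS mulnCA.
have K20 : (0 < K * 2 ^ r.-2)%N by rewrite muln_gt0 K0 expn_gt0.
rewrite -/K KE; split; [exact: LDY| |by have [] := HV _ K20].
have K21 : (0 < 2 * (K * 2 ^ r.-2))%N by rewrite muln_gt0.
by rewrite EDY// expectationB ?Lfun12 ?LYN// !mean_YNE// EFinB.
Qed.

Lemma level_mean_telescope K i : (0 < i)%N ->
  \sum_(1 <= r < i.+1) level_mean K r = mean_YN (K * 2 ^ i.-1).
Proof.
case: i => // i _; elim: i => [|i IH]; first by rewrite big_nat1 muln1.
by rewrite big_nat_recr//= IH /level_mean /= addrC subrK.
Qed.

Lemma level_mean_MLMC n K : (0 < n)%N ->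
  \sum_(1 <= r < n.+1) B MLMC n r * level_mean K r = mean_YN (K * 2 ^ n.-1).
Proof.
move=> n0; rewrite -level_mean_telescope//; apply: eq_bigr => r _.
by rewrite /B; case: ifP => _; rewrite mul1r.
Qed.

Lemma sum_triangle n (w u : nat -> R) :
  \sum_(1 <= r < n.+1) (\sum_(r <= i < n.+1) w i) * u r =
  \sum_(1 <= i < n.+1) w i * \sum_(1 <= r < i.+1) u r.
Proof.
elim: n => [|n IH]; first by rewrite !big_geq.
rewrite [LHS]big_nat_recr//= [RHS]big_nat_recr//= -IH big_nat1.
rewrite (eq_big_nat _ _ (F2 := fun r => (\sum_(r <= i < n.+1) w i) * u r + w n.+1 * u r)).
  by rewrite big_split /= -addrA -mulr_sumr -mulrDr -big_nat_recr.
by move=> r /andP[_ rn]; rewrite big_nat_recr ?mulrDl// ltnW.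
Qed.

Lemma level_mean_ML2R n K : (0 < n)%N ->
  \sum_(1 <= r < n.+1) B ML2R n r * level_mean K r =
  \sum_(1 <= i < n.+1) weight_w alpha n i * mean_YN (K * 2 ^ i.-1).
Proof.
move=> n0.
rewrite (eq_big_nat _ _ (F2 := fun r => weight_W alpha n r * level_mean K r)).
  rewrite sum_triangle; apply: eq_big_nat => i /andP[i1 _].
  by rewrite level_mean_telescope.
by move=> r rn; rewrite /B; case: (eqVneq r 1%N) => [->|//]; rewrite weight_W1.
Qed.

Lemma fine_weak_error Rb c eta N : Y \in Lfun P 2%:E ->
  weak_error P Y YN alpha Rb c eta -> (0 < N)%N ->
  mean_YN N = fine 'E_P[Y]%E + (\sum_(1 <= r < Rb.+1) c r * N%:R `^ (- (alpha * r%:R))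
        + N%:R `^ (- (alpha * Rb%:R)) * eta N).
Proof.
move=> LY [_ /(_ N) H] N0; rewrite /mean_YN H// fineD//.
by rewrite expectation_fin_num// Lfun12.
Qed.

(** The variance uses up eps^2 / M; the hypothesis asks the squared bias to fit into the rest, up to
    slack. *)
Lemma mse_limsup_le1 k (Z : R -> nat -> nat -> T' -> R) :
  (forall e, 0 < e -> indep_copies P P' YN DY (theta k e) (Z e)) ->
  (forall dlt, 0 < dlt -> \forall e \near (0 : R)^'+,
    (fine 'E_P[Y]%E - \sum_(1 <= r < (nR k e).+1)
       B k (nR k e) r * level_mean (opt_Kn alpha ct Ku k e) r) ^+ 2
    <= (1 + dlt - (opt_M k alpha (nR k e))^-1) * e ^+ 2) ->
  (limsup0 (fun e => (e ^- 2)%:E *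
     mse P P' Y (estimator k alpha (theta k e) (Z e))) <= 1)%E.
Proof.
move=> indZ H; apply/lee_addgt0Pr => dlt d0; apply: limsup0_le_near.
near=> e; have e0 : 0 < e by [].
have n0 : (0 < nR k e)%N by near: e; exact: (opt_R_near ct Ku alpha_gt0 k 1).
have e2 : 0 < e ^+ 2 by rewrite exprn_gt0.
rewrite muleC -lee_pdivlMr ?invr_gt0// invrK.
apply: (le_trans (mse_theta_le e0 n0 (indZ e e0))).
rewrite -EFinD -EFinM lee_fin -lerBrDr [leRHS](_ : _ =
  (1 + dlt - (opt_M k alpha (nR k e))^-1) * e ^+ 2); first by near: e; exact: H.
by rewrite mulrBl [_^-1 * _]mulrC.
Unshelve. all: by end_near. Qed.

Lemma mse_limsup_MLMC c eta (Z : R -> nat -> nat -> T' -> R) :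
  Y \in Lfun P 2%:E -> weak_error P Y YN alpha 1 c eta -> ct = `|c 1%N| ->
  (forall e, 0 < e -> indep_copies P P' YN DY (theta MLMC e) (Z e)) ->
  (limsup0 (fun e => (e ^- 2)%:E *
     mse P P' Y (estimator MLMC alpha (theta MLMC e) (Z e))) <= 1)%E.
Proof.
move=> LY we ctE indZ; apply: mse_limsup_le1 => // dlt d0.
have [eta0 _] := we.
have a2 : 0 < 1 + 2 * alpha by rewrite ltr_pwDl// mulr_ge0// ltW.
(* Chosen so that (1 + t)^2 <= 1 + 3 t <= 1 + dlt. *)
pose t := Num.min 1 (dlt / 3).
have t0 : 0 < t by rewrite lt_min ltr01 divr_gt0.
have t1 : t <= 1 by rewrite ge_min lexx.
have t3 : 3 * t <= dlt by rewrite mulrC -ler_pdivlMr// ge_min lexx orbT.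
move/cvgrPdist_le: eta0 => /(_ (t * ct)); rewrite mulr_gt0// => /(_ isT) [N _ HN].
near=> e; have e0 : 0 < e by [].
have n0 : (N < nR MLMC e)%N by near: e; exact: (opt_R_near ct Ku alpha_gt0 MLMC N.+1).
rewrite level_mean_MLMC ?(leq_ltn_trans _ n0)//.
set n := opt_R _ _ _ _ _; set K := opt_Kn _ _ _ _ _.
have K0 : (0 < K)%N by rewrite (leq_trans Ku_gt0)// opt_Kn_ge.
have KN0 : (0 < K * 2 ^ n.-1)%N by rewrite muln_gt0 K0 expn_gt0.
have KN : (N <= K * 2 ^ n.-1)%N.
  rewrite (@leq_trans (2 ^ n.-1)) ?leq_pmull//.
  rewrite (leq_trans _ (ltnW (ltn_expl _ _)))// -ltnS prednK// (leq_ltn_trans _ n0)//.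
rewrite (fine_weak_error LY we KN0) big_nat1 mulr1.
have hK := opt_Kn_powR_MLMC alpha_gt0 ct_gt0 Ku_gt0 e0.
rewrite -/n -/K in hK.
have := HN _ KN; rewrite /= sub0r normrN => hE.
move: hK; set w := _ `^ (- alpha) => hK.
have w0 : 0 <= w by exact: powR_ge0.
set E := fine _.
rewrite opprD addNKr sqrrN [c 1%N * w]mulrC -mulrDr -/(opt_M MLMC alpha n).
set a := (1 + 2 * alpha) `^ _ in hK.
have aE : a ^+ 2 = (1 + 2 * alpha)^-1.
  rewrite -powR_mulrn ?powR_ge0// -powRrM -[RHS]powR_inv1 ?(ltW a2)//.
  by congr (_ `^ _); field.
have a0 : 0 <= a by exact: powR_ge0.
have a1 : a ^+ 2 <= 1 by rewrite aE invf_le1// lerDl mulr_ge0// ltW.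
have cb : `|c 1%N + eta (K * 2 ^ n.-1)%N| <= ct * (1 + t).
  by rewrite (le_trans (ler_normD _ _))// mulrDr mulr1 -ctE lerD2l mulrC.
have wb : `|w * (c 1%N + eta (K * 2 ^ n.-1)%N)| <= a * e * (1 + t).
  rewrite normrM (ger0_norm w0).
  apply: (le_trans (ler_pM w0 (normr_ge0 _) hK cb)).
  by rewrite mulrA divfK// gt_eqF.
rewrite -real_normK ?num_real// (@le_trans _ _ ((a * e * (1 + t)) ^+ 2))//.
  by rewrite ler_sqr ?nnegrE// (le_trans _ wb).
(* The share left by the variance, 1 - 1 / M = 1 / (1 + 2 alpha), is exactly the leading squared
   bias. *)
have -> : 1 + dlt - (opt_M MLMC alpha n)^-1 = a ^+ 2 + dlt.
  rewrite aE /opt_M; field.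
  by rewrite !gt_eqF// addrC.
rewrite !exprMn mulrAC ler_wpM2r ?sqr_ge0//.
have t2 : (1 + t) ^+ 2 <= 1 + dlt by move: t0 t1 t3; nra.
rewrite (le_trans (ler_wpM2l (sqr_ge0 _) t2))//.
by rewrite mulrDr mulr1 lerD2l ler_piMl// ltW.
Unshelve. all: by end_near. Qed.

(** * The bias of ML2R: decay of the remainders and cancellation by the weights *)

Section ML2RBias.
Variables (c : nat -> R) (eta : nat -> nat -> R) (cinf : R).
Hypotheses (LY : Y \in Lfun P 2%:E)
  (we : forall n, (1 <= n)%N -> weak_error P Y YN alpha n c (eta n))
  (etaB : exists b : R, forall n N, (1 <= n)%N -> (1 <= N)%N -> `|eta n N| <= b)
  (ccvg : `|c n| `^ (n%:R)^-1 @[n --> \oo] --> cinf)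
  (cinf_lt : cinf < ct)
  (eta1 : Ku = 1%N -> ct < 1 -> eta n 1%N @[n --> \oo] --> 0).

Lemma coef_le_near : exists n0, forall n, (n0 < n)%N -> `|c n| <= ct ^+ n.
Proof.
move/cvgrPdist_lt: ccvg => /(_ (ct - cinf)); rewrite subr_gt0 => /(_ cinf_lt) [n0 _ H].
exists n0 => n nn0; have := H n (ltnW nn0); rewrite /= ltr_norml => /andP[h _].
have {}h : `|c n| `^ (n%:R)^-1 <= ct by move: h; lra.
have n0' : n%:R != 0 :> R by rewrite pnatr_eq0 -lt0n (leq_ltn_trans _ nn0).
have -> : `|c n| = (`|c n| `^ (n%:R)^-1) ^+ n.
  by rewrite -powR_mulrn ?powR_ge0// -powRrM mulVf// powRr1.
by rewrite lerXn2r ?nnegrE ?powR_ge0// ltW.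
Qed.

(* The expansions of orders [n] and [n + 1] share their first [n] coefficients. *)
Lemma eta_rec n N : (0 < n)%N -> (0 < N)%N ->
  eta n N = N%:R `^ (- alpha) * (c n.+1 + eta n.+1 N).
Proof.
move=> n0 N0; have := fine_weak_error LY (we n0) N0.
rewrite (fine_weak_error LY (we (ltn0Sn n)) N0) => /addrI.
rewrite big_nat_recr//= -addrA => /addrI.
have N0' : 0 < N%:R :> R by rewrite ltr0n.
have -> : N%:R `^ (- (alpha * n.+1%:R)) =
    N%:R `^ (- (alpha * n%:R)) * N%:R `^ (- alpha) :> R.
  by rewrite -powRD_gt0// -natr1; congr (_ `^ _); ring.
have p0 : N%:R `^ (- (alpha * n%:R)) != 0 :> R by rewrite gt_eqF// powR_gt0.
by rewrite [c _ * _]mulrC -mulrDr -mulrA => /(mulfI p0) ->.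
Qed.

(** Iterates [eta_rec]. The powers of N^(-alpha) are dropped in front of the coefficients but kept
    on the last remainder, where they provide the contraction. *)
Lemma eta_iter n N m : (0 < n)%N -> (0 < N)%N ->
  `|eta n N| <= \sum_(0 <= j < m) `|c (n + j.+1)%N|
    + (N%:R `^ (- alpha)) ^+ m * `|eta (n + m)%N N|.
Proof.
move=> n0 N0; have w0 : 0 <= N%:R `^ (- alpha) :> R by exact: powR_ge0.
have w1 : N%:R `^ (- alpha) <= 1 :> R.
  by rewrite powRN invf_le1 ?powR_gt0 ?ltr0n// -[leLHS](powRr0 N%:R) ler_powR ?ler1n// ltW.
elim: m => [|m IH]; first by rewrite big_geq// add0r mul1r addn0.
apply: (le_trans IH); rewrite big_nat_recr//= -addrA lerD2l.
rewrite (@eta_rec (n + m)) ?addn_gt0 ?n0// normrM (ger0_norm w0) mulrA -exprSr addnS.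
apply: (le_trans (ler_wpM2l _ (ler_normD _ _))); first exact: exprn_ge0.
by rewrite mulrDr lerD2r ler_piMl// exprn_ile1.
Qed.

(* For [N > 1] the recursion on [eta] is a contraction; for [N = 1], which is
   reached only if [Ku = 1], the hypothesis [eta1] replaces the contraction. *)
Lemma eta_tail : ct < 1 -> exists n0, forall n N, (n0 < n)%N -> (0 < N)%N ->
  (1 < N)%N \/ Ku = 1%N -> `|eta n N| <= ct ^+ n * (1 - ct)^-1.
Proof.
move=> ct1; have [n0 Hc] := coef_le_near; have [b Hb] := etaB.
exists n0 => n N nn0 N0 hN; have n00 : (0 < n)%N by rewrite (leq_ltn_trans _ nn0).
apply/ler_addgt0Pr => z z0.
(* The coefficients are summed by a geometric series of ratio ct, uniformly in m, so only the last
   remainder has to be made small. *)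
suff [m hm] : exists m, (N%:R `^ (- alpha)) ^+ m * `|eta (n + m)%N N| <= z.
  apply: (le_trans (eta_iter m n00 N0)); apply: lerD => //.
  apply: (@le_trans _ _ (\sum_(0 <= j < m) ct ^+ n * ct ^+ j)).
    apply: ler_sum_nat => j _; apply: (le_trans (Hc _ _)).
      by rewrite (leq_trans nn0)// leq_addr.
    by rewrite addnS exprS exprD ler_piMl ?mulr_ge0 ?exprn_ge0// ltW.
  rewrite -mulr_sumr ler_wpM2l ?exprn_ge0 ?(ltW ct_gt0)//.
  by rewrite geometric_sum_le// (ltW ct_gt0).
have [N1|] := eqVneq N 1%N; last first.
  move=> N1; have {}N1 : (1 < N)%N by rewrite ltn_neqAle eq_sym N1.
  pose w : R := N%:R `^ (- alpha).
  have w0 : 0 <= w by exact: powR_ge0.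
  have w1 : w < 1.
    rewrite /w powR_expR ?ltr0n// expR_lt1 mulNr oppr_lt0 mulr_gt0// ln_gt0//.
    by rewrite ltr1n.
  have b0 : 0 <= b by apply: (le_trans _ (Hb 1%N 1%N _ _)).
  have : w ^+ m @[m --> \oo] --> 0 by apply: cvg_expr; rewrite ger0_norm.
  move=> /cvgrPdist_le /(_ (z / (b + 1))); rewrite divr_gt0 ?ltr_wpDl// => /(_ isT).
  move=> [m _ Hm]; exists m; have := Hm m (leqnn _).
  rewrite /= sub0r normrN ger0_norm ?exprn_ge0// => wz.
  apply: (le_trans (ler_pM _ _ wz (Hb _ _ _ _))); rewrite ?exprn_ge0 ?addn_gt0 ?n00//.
  rewrite mulrAC ler_pdivrMr ?ltr_wpDl// ler_wpM2l ?(ltW z0)//.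
  by rewrite lerDl.
have K1 : Ku = 1%N by case: hN => //; rewrite N1.
move/cvgrPdist_le: (eta1 K1 ct1) => /(_ _ z0) [m _ Hm]; exists m.
have := Hm (n + m)%N (leq_addl _ _); rewrite /= sub0r normrN N1.
by rewrite powR1 expr1n mul1r.
Qed.

(** For ct >= 1 a bounded remainder is already O(ct^n); for ct < 1 the decay comes from
    [eta_tail]. *)
Lemma remainder_le : exists2 C, 0 <= C & exists n0, forall n N, (n0 < n)%N ->
  (0 < N)%N -> (1 < N)%N \/ Ku = 1%N -> `|c n + eta n N| <= C * ct ^+ n.
Proof.
have [n0 Hc] := coef_le_near.
have [ct1|ct1] := ltP ct 1.
  have [n1 He] := eta_tail ct1.
  exists (1 + (1 - ct)^-1); first by rewrite addr_ge0// invr_ge0 subr_ge0 ltW.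
  exists (maxn n0 n1) => n N; rewrite gtn_max => /andP[nn0 nn1] N0 hN.
  rewrite (le_trans (ler_normD _ _))// mulrDl mul1r lerD ?Hc//.
  by rewrite mulrC He.
have [b Hb] := etaB.
have b0 : 0 <= b by apply: (le_trans _ (Hb 1%N 1%N _ _)).
exists (1 + b); first exact: addr_ge0.
exists n0 => n N nn0 N0 _; rewrite (le_trans (ler_normD _ _))// mulrDl mul1r lerD ?Hc//.
by rewrite (le_trans (Hb _ _ _ _)) ?(leq_ltn_trans _ nn0)// ler_peMr// exprn_ege1.
Qed.

(* The weights annihilate the powers 1, ..., n - 1 of the nodes, so only the
   coefficient c_n and the remainder contribute to the bias. *)
Lemma bias_ML2R n K : (0 < n)%N -> (0 < K)%N ->
  fine 'E_P[Y]%E - \sum_(1 <= r < n.+1) B ML2R n r * level_mean K r =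
  - (K%:R `^ (- (alpha * n%:R)) * \sum_(1 <= i < n.+1) weight_w alpha n i *
      (2 `^ (- alpha)) ^+ (i.-1 * n) * (c n + eta n (K * 2 ^ i.-1)%N)).
Proof.
move=> n0 K0; rewrite level_mean_ML2R//.
set E := fine _; set y := 2 `^ (- alpha).
have powE i r : (K * 2 ^ i)%:R `^ (- (alpha * r%:R)) =
    K%:R `^ (- (alpha * r%:R)) * y ^+ (i * r) :> R.
  rewrite natrM powRM//; congr (_ * _).
  rewrite natrX -powR_mulrn// -powRrM -powR_mulrn ?powR_ge0// -powRrM natrM.
  by congr (_ `^ _); ring.
have mE i : mean_YN (K * 2 ^ i.-1) = E +
    \sum_(1 <= r < n.+1) c r * K%:R `^ (- (alpha * r%:R)) * y ^+ (i.-1 * r)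
    + K%:R `^ (- (alpha * n%:R)) * y ^+ (i.-1 * n) * eta n (K * 2 ^ i.-1)%N.
  rewrite (fine_weak_error LY (we n0)) ?muln_gt0 ?K0 ?expn_gt0// addrA powE.
  by congr (_ + _ + _); apply: eq_bigr => r _; rewrite powE mulrA.
under eq_bigr do rewrite mE mulrDr mulrDr.
rewrite !big_split /= -mulr_suml.
have -> : \sum_(1 <= i < n.+1) weight_w alpha n i = 1.
  by have := weight_W1 alpha_gt0 n0.
under [X in 1 * E + X]eq_bigr do rewrite mulr_sumr.
rewrite mul1r exchange_big_nat/=.
set S := (X in E + X + _).
have -> : S = c n * K%:R `^ (- (alpha * n%:R)) *
    \sum_(1 <= i < n.+1) weight_w alpha n i * y ^+ (i.-1 * n).
  rewrite /S big_nat_recr//= big_nat_cond big1 ?add0r.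
    by rewrite mulr_sumr; apply: eq_bigr => i _; rewrite mulrCA.
  move=> r /andP[/andP[r1 rn] _].
  under eq_bigr do rewrite mulrCA.
  rewrite -mulr_sumr (sum_weight_w_moment alpha_gt0 rn).
  by case: r r1 {rn} => // r _; rewrite mulr0.
rewrite -addrA opprD addNKr; congr (- _); rewrite mulr_sumr mulr_sumr -big_split /=.
by apply: eq_bigr => i _; ring.
Qed.

Lemma mse_limsup_ML2R (Z : R -> nat -> nat -> T' -> R) :
  (forall e, 0 < e -> indep_copies P P' YN DY (theta ML2R e) (Z e)) ->
  (limsup0 (fun e => (e ^- 2)%:E *
     mse P P' Y (estimator ML2R alpha (theta ML2R e) (Z e))) <= 1)%E.
Proof.
move=> indZ; apply: mse_limsup_le1 => // dlt d0.
have [C C0 [n0 HC]] := remainder_le.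
set y := 2 `^ (- alpha); pose A := weight_bound alpha / (1 - y).
have A0 : 0 <= A.
  rewrite divr_ge0 ?weight_bound_ge0// subr_ge0 ltW// powR2_lt1//.
  by rewrite oppr_lt0.
(* Beyond this level (A C)^2 / (1 + 2 alpha n) <= dlt, so the slack alone absorbs the squared
   bias. *)
pose n1 := ceiln ((A * C) ^+ 2 / dlt / (2 * alpha) + 1).
near=> e; have e0 : 0 < e by [].
have nn0 : (maxn n0 n1 < nR ML2R e)%N.
  by near: e; exact: (opt_R_near ct Ku alpha_gt0 ML2R (maxn n0 n1).+1).
move: nn0; rewrite gtn_max => /andP[nn0 nn1].
have np : (0 < nR ML2R e)%N by rewrite (leq_ltn_trans _ nn0).
have K0 : (0 < opt_Kn alpha ct Ku ML2R e)%N.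
  by rewrite (leq_trans Ku_gt0)// opt_Kn_ge.
rewrite bias_ML2R// sqrrN.
have hK := opt_Kn_powR_ML2R alpha_gt0 ct_gt0 Ku_gt0 e0 np.
have KKu : (Ku <= opt_Kn alpha ct Ku ML2R e)%N by exact: opt_Kn_ge.
move: hK KKu K0; set K := opt_Kn _ _ _ _ _; set n := opt_R _ _ _ _ _ in nn0 nn1 np *.
move=> hK KKu K0.
have rem i : (1 <= i)%N -> `|c n + eta n (K * 2 ^ i.-1)%N| <= C * ct ^+ n.
  move=> i1; apply: HC => //; first by rewrite muln_gt0 K0 expn_gt0.
  (* Since Ku <= K, a sample size 1 can occur only for Ku = 1, the case covered by the alternative
     in [remainder_le]. *)
  have [K1|K1] := eqVneq K 1%N; last first.
    left; rewrite (@leq_trans K)//; last by rewrite leq_pmulr// expn_gt0.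
    by rewrite ltn_neqAle eq_sym K1.
  by right; apply/eqP; rewrite eqn_leq Ku_gt0 andbT -K1.
set w := K%:R `^ _ in hK *; have w0 : 0 <= w by exact: powR_ge0.
set S := \sum_(1 <= i < n.+1) _.
have SA : `|S| <= A * y ^+ 'C(n, 2) * (C * ct ^+ n).
  apply: (le_trans (ler_norm_sum _ _ _)).
  apply: (@le_trans _ _ (\sum_(1 <= i < n.+1)
      `|weight_w alpha n i| * y ^+ (i.-1 * n) * (C * ct ^+ n))).
    apply: ler_sum_nat => i /andP[i1 _]; rewrite !normrM.
    rewrite (ger0_norm (exprn_ge0 _ (powR_ge0 _ _))); apply: ler_wpM2l (rem i i1).
    by rewrite mulr_ge0// exprn_ge0// powR_ge0.
  rewrite -mulr_suml ler_wpM2r ?mulr_ge0 ?exprn_ge0 ?(ltW ct_gt0)//.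
  exact: sum_weight_w_node_le.
set a := (1 + 2 * alpha * n%:R) `^ _ in hK.
have a2 : 0 < 1 + 2 * alpha * n%:R by rewrite ltr_pwDl// !mulr_ge0// ltW.
have aE : a ^+ 2 = (1 + 2 * alpha * n%:R)^-1.
  rewrite -powR_mulrn ?powR_ge0// -powRrM -[RHS]powR_inv1 ?(ltW a2)//.
  by congr (_ `^ _); field.
have bound : `|w * S| <= A * C * a * e.
  rewrite normrM (ger0_norm w0); apply: (le_trans (ler_wpM2l w0 SA)).
  have mulE (p q r s t : R) : p * (q * r * (s * t)) = q * s * (p * r) * t by ring.
  rewrite mulE.
  apply: (@le_trans _ _ (A * C * (a * e * (ct ^+ n)^-1) * ct ^+ n)).
    rewrite ler_wpM2r ?exprn_ge0 ?(ltW ct_gt0)//.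
    by apply: ler_wpM2l; [exact: mulr_ge0 A0 C0|exact: hK].
  have divE (p q r s : R) : s != 0 -> p * (q * r * s^-1) * s = p * q * r.
    by move=> s0; field.
  by rewrite divE// gt_eqF// exprn_gt0.
rewrite -real_normK ?num_real// (@le_trans _ _ ((A * C * a * e) ^+ 2))//.
  by rewrite ler_sqr ?nnegrE// (le_trans _ bound).
rewrite exprMn ler_wpM2r ?sqr_ge0// exprMn aE.
have M1 : (opt_M ML2R alpha n)^-1 <= 1.
  by rewrite invf_le1 ?opt_M_gt0// /opt_M lerDl invr_ge0 !mulr_ge0// ltW.
have : (A * C) ^+ 2 / (1 + 2 * alpha * n%:R) <= dlt.
  rewrite ler_pdivrMr// -ler_pdivrMl//.
  apply: (@le_trans _ _ (2 * alpha * n%:R)); last by rewrite lerDr.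
  rewrite -ler_pdivrMl ?mulr_gt0//.
  have x0 : 0 < (A * C) ^+ 2 / dlt / (2 * alpha) + 1.
    by rewrite ltr_wpDl// divr_ge0 ?divr_ge0 ?sqr_ge0 ?(ltW d0)// mulr_ge0// ltW.
  apply: (@le_trans _ _ n1%:R); last by rewrite ler_nat ltnW.
  by rewrite (le_trans _ (ceiln_ge x0))// [leLHS]mulrC [dlt^-1 * _]mulrC lerDl.
by move=> h; apply: (le_trans h); rewrite addrAC lerDr subr_ge0.
Unshelve. all: by end_near. Qed.

End ML2RBias.

End MeanSquareError.

Theorem theorem4 (R : realType)
  (d : measure_display) (T : measurableType d) (P : probability T R)
  (d' : measure_display) (T' : measurableType d') (P' : probability T' R)
  (dX dU : nat) (F : dX.-tuple R * dU.-tuple R -> R) (f : R -> R)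
  (X : T -> dX.-tuple R) (U : T -> dU.-tuple R) (Us : nat -> T -> dU.-tuple R)
  (L : T -> R) (DY : nat -> T -> R)
  (hset : nested_setting P F f X U Us L DY)
  (tau alpha beta V1 sigma : R) (Ku : nat)
  (htau : 0 <= tau) (halpha : 0 < alpha) (hbeta : 0 < beta)
  (hV1 : 0 < V1) (hsigma : 0 < sigma) (hKu : (1 <= Ku)%N) :
  let Y := f \o L in
  let YN := nested_Y F f X Us in
  let theta k ct := theta_eps k alpha beta V1 sigma ct Ku in
  (* comparison of the costs *)
  [/\ forall (k : ml_kind) (ct : R), 0 < ct ->
        forall dinf : R,
          (1 < beta -> 0 < dinf /\
             mean_inner_cost (theta k ct eps) @[eps --> 0^'+] --> dinf) ->
        forall v : R -> R,
          (limsup0 (fun eps => (v eps * cost 0 (theta k ct eps))%:E) < +oo)%E ->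
          (limsup0 (fun eps => (v eps * cost tau (theta k ct eps))%:E) <=
           (cost_factor beta tau dinf)%:E *
           limsup0 (fun eps => (v eps * cost 0 (theta k ct eps))%:E))%E,
      (* beta > 1: the limit exists for MLMC *)
      forall ct : R, 0 < ct -> 1 < beta ->
        exists2 dinf : R, 0 < dinf &
          mean_inner_cost (theta MLMC ct eps) @[eps --> 0^'+] --> dinf,
      (* beta > 1: for ML2R, a lower limit is used instead *)
      forall ct : R, 0 < ct -> 1 < beta ->
        exists2 dinf : R,
          0 < dinf /\
          limf_einf (fun eps => (mean_inner_cost (theta ML2R ct eps))%:E) 0^'+
            = dinf%:E &
          forall v : R -> R, (\forall eps \near 0^'+, 0 <= v eps) ->
            (limsup0 (fun eps => (v eps * cost 0 (theta ML2R ct eps))%:E) < +oo)%E ->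
            (limsup0 (fun eps => (v eps * cost tau (theta ML2R ct eps))%:E) <=
             (cost_factor beta tau dinf)%:E *
             limsup0 (fun eps => (v eps * cost 0 (theta ML2R ct eps))%:E))%E,
      (* (a) *)
      forall (c : nat -> R) (eta : nat -> nat -> R) (cinf ctil : R)
             (Z : R -> nat -> nat -> T' -> R),
        let th := theta ML2R ctil in
        (forall Rb, (1 <= Rb)%N -> weak_error P Y YN alpha Rb c (eta Rb)) ->
        var_bound P YN DY beta V1 sigma ->
        (exists B : R, forall Rb N, (1 <= Rb)%N -> (1 <= N)%N ->
           `|eta Rb N| <= B) ->
        `|c Rb| `^ (Rb%:R)^-1 @[Rb --> \oo] --> cinf ->
        0 < cinf -> cinf < ctil ->
        (forall eps, 0 < eps ->
           indep_copies P P' YN DY (th eps) (Z eps)) ->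
        (exists2 C : R, 0 <= C &
           (limsup0 (fun eps =>
              (rate ML2R alpha beta eps * cost tau (th eps))%:E)
            <= C%:E)%E) /\
        ((Ku = 1%N -> ctil < 1 -> eta Rb 1%N @[Rb --> \oo] --> 0) ->
         (limsup0 (fun eps => (eps ^- 2)%:E *
            mse P P' Y (estimator ML2R alpha (th eps) (Z eps)))
          <= 1)%E)
    & (* (b) *)
      forall (c eta : nat -> R) (Z : R -> nat -> nat -> T' -> R),
        let th := theta MLMC `|c 1%N| in
        weak_error P Y YN alpha 1 c eta -> c 1%N != 0 ->
        var_bound P YN DY beta V1 sigma ->
        (forall eps, 0 < eps ->
           indep_copies P P' YN DY (th eps) (Z eps)) ->
        (exists2 C : R, 0 <= C &
           (limsup0 (fun eps =>
              (rate MLMC alpha beta eps * cost tau (th eps))%:E)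
            <= C%:E)%E) /\
        (limsup0 (fun eps => (eps ^- 2)%:E *
            mse P P' Y (estimator MLMC alpha (th eps) (Z eps)))
          <= 1)%E].
Proof.
move=> Y YN theta.
have LYN := ns_YN hset; have LDY := ns_DY hset; have EDY := ns_EDY hset.
have LY := ns_Y hset.
split.
- move=> k ct ct0 dinf hd v.
  exact: limsup0_cost_le.
- move=> ct ct0 b1; exact: mean_inner_cost_MLMC_cvg.
- move=> ct ct0 b1; exact: limsup0_cost_ML2R_le.
- move=> c eta cinf ctil Z th we vb etaB ccvg cinf0 cinfct indZ.
  have ct0 : 0 < ctil by exact: lt_trans cinfct.
  split; first exact: rate_cost_le.
  move=> eta1.
  exact: (mse_limsup_ML2R LYN LDY EDY vb halpha hV1 hsigma ct0 hKu LY we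
    etaB ccvg cinfct eta1 indZ).
- move=> c eta Z th we c0 vb indZ.
  have ct0 : 0 < `|c 1%N| by rewrite normr_gt0.
  split; first exact: rate_cost_le.
  exact: (mse_limsup_MLMC LYN LDY EDY vb halpha hV1 hsigma ct0 hKu LY we
    erefl indZ).
Qed.
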